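(* Let $X$ be an uncountable compact metric space and let $n$ be a positive integer. If $\dim_{\mathrm H} X = 0$, then the set \[ \{ f \in C_n(X) : \dim_{\mathrm H} G_f = n \} \] is prevalent in $C_n(X)$. If $\dim_{\mathrm P} X = 0$, then the set \[ \{ f \in C_n(X) : \dim_{\mathrm H} G_f = \dim_{\mathrm P} G_f = n \} \] is also prevalent in $C_n(X)$.
   Context: $C_n(X)$ is the Banach space of all continuous functions $f\colon X\to\mathbb{R}^n$ with the supremum norm. The graph of $f$ is $G_f=\{(x,f(x)):x\in X\}\subseteq X\times\mathbb{R}^n$, where $X\times\mathbb{R}^n$ carries a standard product metric (for instance the maximum of the metric on $X$ and the Euclidean metric; the usual choices are bi-Lipschitz equivalent). $\dim_{\mathrm H}$ is Hausdorff dimension. $\dim_{\mathrm P}$ is packing dimension, $\dim_{\mathrm P} F=\inf\{\sup_i \overline{\dim}_{\mathrm B} F_i : F\subseteq \bigcup_{i=1}^\infty F_i\}$ with the $F_i$ totally bounded (equivalently, the dimension defined by packing measures), where $\overline{\dim}_{\mathrm B}F=\limsup_{\delta\to0}\log N_\delta(F)/(-\log\delta)$ and $N_\delta(F)$ is the smallest number of sets of diameter at most $\delta$ needed to cover $F$. Prevalence: for a Banach space $E$, a Borel set $S\subseteq E$ is shy if there is a compactly supported Borel probability measure $\mu$ on $E$ such that $\mu(S+x)=0$ for all $x\in E$. A non-Borel set is shy if it is contained in a shy Borel set. The complement of a shy set is called prevalent. *)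

(* Defs.v *)
From HB Require Import structures.
From mathcomp Require Import all_boot all_order all_algebra.
From mathcomp Require Import all_classical all_reals all_analysis.
From mathcomp Require Import ring lra.

Set Implicit Arguments.
Unset Strict Implicit.
Unset Printing Implicit Defensive.

Import Order.TTheory GRing.Theory Num.Theory.
Import numFieldNormedType.Exports.

Local Open Scope classical_set_scope.
Local Open Scope ring_scope.

(* An alias of ['rV[R]_n], because the library norms ['rV[R]_n] by the
   maximum of the coordinates. *)
Definition eucl (R : realType) (n : nat) : Type := 'rV[R]_n.

Section eucl.
Variables (R : realType) (n : nat).
Implicit Types u v : 'rV[R]_n.

Definition enorm u : R := Num.sqrt (\sum_i u 0 i ^+ 2).

Lemma enorm_sqr u : enorm u ^+ 2 = \sum_i u 0 i ^+ 2.
Proof. by rewrite sqr_sqrtr// sumr_ge0// => i _; exact: sqr_ge0. Qed.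

Lemma enorm_ge0 u : 0 <= enorm u.
Proof. exact: sqrtr_ge0. Qed.

Lemma coord_le_enorm u i : `|u 0 i| <= enorm u.
Proof.
rewrite -sqrtr_sqr ler_wsqrtr// (bigD1 i)//= lerDl.
by rewrite sumr_ge0// => j _; exact: sqr_ge0.
Qed.

Lemma dot_le_enorm u v : \sum_i u 0 i * v 0 i <= enorm u * enorm v.
Proof.
have [u0|u0] := eqVneq (enorm u) 0.
  rewrite u0 mul0r big1// => i _; have := coord_le_enorm u i.
  by rewrite u0 normr_le0 => /eqP ->; rewrite mul0r.
have [v0|v0] := eqVneq (enorm v) 0.
  rewrite v0 mulr0 big1// => i _; have := coord_le_enorm v i.
  by rewrite v0 normr_le0 => /eqP ->; rewrite mulr0.
have up : 0 < enorm u by rewrite lt_neqAle eq_sym u0 enorm_ge0.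
have vp : 0 < enorm v by rewrite lt_neqAle eq_sym v0 enorm_ge0.
have : 0 <= \sum_i (enorm v * u 0 i - enorm u * v 0 i) ^+ 2.
  by rewrite sumr_ge0// => i _; exact: sqr_ge0.
rewrite (eq_bigr (fun i => enorm v ^+ 2 * u 0 i ^+ 2
    + enorm u ^+ 2 * v 0 i ^+ 2
    - (2 * enorm u * enorm v) * (u 0 i * v 0 i))); last by move=> i _; ring.
rewrite sumrB big_split/= -!mulr_sumr -!enorm_sqr.
set d := \sum_i _ => h.
have : 0 <= (2 * enorm u * enorm v) * (enorm u * enorm v - d) by nra.
by rewrite pmulr_rge0 ?mulr_gt0// subr_ge0.
Qed.

Lemma enormD u v : enorm (u + v) <= enorm u + enorm v.
Proof.
rewrite -(@ler_pXn2r _ 2)// ?nnegrE ?addr_ge0 ?enorm_ge0//.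
rewrite sqrrD !enorm_sqr.
rewrite (eq_bigr (fun i => u 0 i ^+ 2 + v 0 i ^+ 2 + 2 * (u 0 i * v 0 i)));
  last by move=> i _; rewrite mxE; ring.
rewrite !big_split/= -mulr_sumr.
have := dot_le_enorm u v; rewrite -mulr_natl.
set d := \sum_i _ * _; set p := enorm u * enorm v => ?; lra.
Qed.

Lemma enormZ (l : R) u : enorm (l *: u) = `|l| * enorm u.
Proof.
rewrite /enorm -sqrtr_sqr -sqrtrM ?sqr_ge0// mulr_sumr; congr Num.sqrt.
by apply: eq_bigr => i _; rewrite mxE exprMn.
Qed.

Lemma enorm_eq0 u : enorm u = 0 -> u = 0.
Proof.
move=> u0; apply/rowP => i; rewrite mxE; apply/eqP.
by rewrite -normr_le0 -u0 coord_le_enorm.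
Qed.

HB.instance Definition _ := GRing.Lmodule.copy (eucl R n) 'rV[R]_n.

HB.instance Definition _ := Lmodule_isNormed.Build R (eucl R n)
  enormD enormZ enorm_eq0.

End eucl.

Section eucl_metric.
Variables (R : realType) (n : nat).

Let dist (u v : eucl R n) : R := `|u - v|.

Let dist_ge0 u v : 0 <= dist u v. Proof. exact: normr_ge0. Qed.

Let dist_positivity u v : dist u v = 0 -> u = v.
Proof. by move/eqP; rewrite normr_eq0 subr_eq0 => /eqP. Qed.

Let ballEdist u d : ball u d = [set v | dist u v < d].
Proof. by rewrite -ball_normE. Qed.

HB.instance Definition _ := PseudoMetric_isMetric.Build R (eucl R n)
  dist_ge0 dist_positivity ballEdist.

End eucl_metric.

Section eucl_complete.
Variables (R : realType) (n : nat).

Lemma enorm_le (u : 'rV[R]_n) (M : R) : 0 <= M ->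
  (forall i, `|u 0 i| <= M) -> enorm u <= n%:R * M.
Proof.
move=> M0 uM; rewrite -[leRHS]ger0_norm ?mulr_ge0// -sqrtr_sqr.
apply: ler_wsqrtr.
have h : \sum_i u 0 i ^+ 2 <= \sum_(i < n) M ^+ 2.
  apply: ler_sum => i _; rewrite -real_normK ?num_real//.
  by rewrite lerXn2r ?nnegrE.
apply: (le_trans h); rewrite sumr_const card_ord -[leLHS]mulr_natl exprMn.
apply: ler_wpM2r; first exact: sqr_ge0.
rewrite -natrX ler_nat expnS expn1.
by case: (n) => // k; rewrite leq_pmulr.
Qed.

Let eucl_cauchy_cvg (F : set_system (eucl R n)) :
  ProperFilter F -> cauchy F -> cvg F.
Proof.
move=> FF /cauchyP cF.
pose G := (fun u : eucl R n => (u : 'rV[R]_n)) @ F.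
have cG : cauchy G.
  apply/cauchyP => e e0; have [u Fu] := cF _ e0; exists (u : 'rV[R]_n).
  apply: filterS Fu => v uv; have {}uv : `|u - v : eucl R n| < e by [].
  split=> // i j; rewrite (ord1 i) /ball/=; apply: le_lt_trans uv.
  by have := coord_le_enorm (u - v) j; rewrite !mxE.
have /cvg_ex : cvg G by exact: cauchy_cvg.
move=> [l Gl].
apply/cvg_ex; exists (l : eucl R n).
apply/(@cvgrPdist_le _ _ _ F _ id) => e e0.
have e'0 : 0 < e / n.+1%:R by rewrite divr_gt0.
have : F [set u | ball (l : 'rV[R]_n) (e / n.+1%:R) (u : 'rV[R]_n)].
  by apply: (Gl (ball _ _)); exact: nbhsx_ballx.
apply: filterS => u [_ lu]; apply: le_trans (enorm_le (ltW e'0) _) _.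
  by move=> i; have := ltW (lu 0 i); rewrite !mxE.
by rewrite mulrCA ger_pMr// ler_pdivrMr// mul1r ler_nat.
Qed.

HB.instance Definition _ :=
  Uniform_isComplete.Build (eucl R n) eucl_cauchy_cvg.

End eucl_complete.

Section prod_metric.
Variables (R : realType) (X Y : metricType R).

Let dist (p q : X * Y) : R := Num.max (mdist p.1 q.1) (mdist p.2 q.2).

Let dist_ge0 p q : 0 <= dist p q.
Proof. by rewrite le_max mdist_ge0. Qed.

Let dist_positivity p q : dist p q = 0 -> p = q.
Proof.
case: p q => [p1 p2] [q1 q2] /eqP; rewrite eq_le ge_max => /andP[/andP[/= h1 h2] _].
by congr (_, _); apply: mdist_positivity; apply/eqP;
  rewrite eq_le mdist_ge0 andbT.
Qed.

Let ballEdist p d : ball p d = [set q | dist p q < d].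
Proof.
apply/seteqP; split=> q; rewrite /ball/= /prod_ball/= !ballEmdist/= /dist gt_max.
  by move=> [-> ->].
by move=> /andP[].
Qed.

HB.instance Definition _ := PseudoMetric_isMetric.Build R (X * Y)%type
  dist_ge0 dist_positivity ballEdist.

End prod_metric.

Definition continuous_pred (X V : topologicalType) : {pred X -> V} :=
  mem [set f : X -> V | continuous f].

(* Compactness of [X], which makes the supremum norm finite, is a parameter
   of the type so that the instances below can use it. *)
Record contfun (R : realType) (X : topologicalType) (cX : compact [set: X])
    (V : normedModType R) := ContFun {
  contfun_fun :> X -> V ;
  _ : contfun_fun \in @continuous_pred X V }.

Section contfun.
Variables (R : realType) (X : topologicalType) (cX : compact [set: X]).
Variable V : normedModType R.
Local Notation C := (contfun cX V).

HB.instance Definition _ := [isSub for @contfun_fun R X cX V].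
HB.instance Definition _ := [Choice of C by <:].

Lemma contfun_continuous (f : C) : continuous f.
Proof. by have := valP f; rewrite inE. Qed.

Lemma contfun_submod_closed : submod_closed (@continuous_pred X V).
Proof.
split; first by rewrite inE => x; exact: cst_continuous.
move=> a f g; rewrite !inE => cf cg x.
by apply: cvgD; [apply: cvgZr; exact: cf|exact: cg].
Qed.

HB.instance Definition _ :=
  GRing.isSubmodClosed.Build _ _ (@continuous_pred X V) contfun_submod_closed.
HB.instance Definition _ := [SubChoice_isSubLmodule of C by <:].

Definition supnorm (f : C) : R := sup (range (fun x => `|f x|)).

Lemma supnorm_has_ubound (f : C) : has_ubound (range (fun x => `|f x|)).
Proof.
have [M [_ fM]] : bounded_set (range f).
  apply/compact_bounded/continuous_compact => //.
  by apply/continuous_subspaceT => x; exact: contfun_continuous.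
exists (M + 1) => _ [x _ <-]; apply: (fM (M + 1)); first by rewrite ltrDl.
by exists x.
Qed.

Lemma le_supnorm (f : C) x : `|f x| <= supnorm f.
Proof. by apply: ub_le_sup; [exact: supnorm_has_ubound|exists x]. Qed.

Lemma supnorm_ge0 (f : C) : 0 <= supnorm f.
Proof.
have [[x _]|X0] := pselect ([set: X] !=set0).
  exact: (le_trans (normr_ge0 (f x)) (le_supnorm f x)).
suff : range (fun x => `|f x|) = set0 by rewrite /supnorm => ->; rewrite sup0.
by rewrite -subset0 => y [x _ _]; apply: X0; exists x.
Qed.

Lemma supnorm_le (f : C) (M : R) :
  0 <= M -> (forall x, `|f x| <= M) -> supnorm f <= M.
Proof.
move=> M0 fM; have [[x _]|X0] := pselect ([set: X] !=set0).
  apply: ge_sup; first by exists `|f x|; exists x.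
  by move=> _ [y _ <-].
suff : range (fun x => `|f x|) = set0 by rewrite /supnorm => ->; rewrite sup0.
by rewrite -subset0 => y [x _ _]; apply: X0; exists x.
Qed.

Let supnormD (f g : C) : supnorm (f + g) <= supnorm f + supnorm g.
Proof.
apply: supnorm_le => [|x]; first by rewrite addr_ge0 ?supnorm_ge0.
by apply: le_trans (ler_normD _ _) _; rewrite lerD ?le_supnorm.
Qed.

Let supnormZ (l : R) (f : C) : supnorm (l *: f) = `|l| * supnorm f.
Proof.
apply/eqP; rewrite eq_le; apply/andP; split.
  apply: supnorm_le => [|x]; first by rewrite mulr_ge0 ?supnorm_ge0.
  by rewrite [leLHS](normrZ l (f x)) ler_wpM2l ?le_supnorm.
have [->|l0] := eqVneq l 0; first by rewrite normr0 mul0r supnorm_ge0.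
have l0' : 0 < `|l| by rewrite normr_gt0.
rewrite -ler_pdivlMl//; apply: supnorm_le => [|x].
  by rewrite mulr_ge0 ?invr_ge0 ?supnorm_ge0.
by rewrite ler_pdivlMl// -normrZ; exact: (le_supnorm (l *: f) x).
Qed.

Let supnorm_eq0 (f : C) : supnorm f = 0 -> f = 0.
Proof.
move=> f0; apply/val_inj/funext => x; apply/eqP.
by rewrite -normr_le0 -[leRHS]f0; exact: le_supnorm.
Qed.

HB.instance Definition _ := Lmodule_isNormed.Build R C
  supnormD supnormZ supnorm_eq0.

End contfun.

Section contfun_complete.
Variables (R : realType) (X : topologicalType) (cX : compact [set: X]).
Variable V : completeNormedModType R.
Local Notation C := (contfun cX V).

Let contfun_cauchy_cvg (F : set_system C) :
  ProperFilter F -> cauchy F -> cvg F.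
Proof.
move=> FF /cauchyP cF.
have dist_le (f g : C) x : `|f x - g x| <= `|f - g|.
  exact: (le_supnorm (f - g) x).
have /choice[g Fg] x : exists l : V, (fun f : C => f x) @ F --> l.
  have FFx : ProperFilter ((fun f : C => f x) @ F).
    exact: fmap_proper_filter.
  apply/cvg_ex; apply: cauchy_cvg; apply/cauchyP => e e0.
  have [f Ff] := cF _ e0.
  exists (f x); rewrite -ball_normE.
  suff : F [set h : C | `|f x - h x| < e] by [].
  apply: filterS Ff => h; rewrite -ball_normE /= => fh.
  exact: le_lt_trans fh.
have near_g (e : R) : 0 < e ->
    exists2 f : C, F (ball f e) & forall x, `|f x - g x| <= e.
  move=> e0; have [f Ff] := cF _ e0; exists f => // x.
  apply: (@closed_cvg _ _ F FF (fun h : C => h x) [set v | `|f x - v| <= e]).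
  - have -> : [set v | `|f x - v| <= e] = closed_ball_ Num.norm (f x) e by [].
    exact: closed_closed_ball_.
  - apply: filterS Ff => h; rewrite -ball_normE /= => /ltW.
    exact: le_trans.
  - exact: Fg.
have cg : continuous g.
  move=> x; apply/cvgrPdist_le => e e0.
  have e30 : 0 < e / 3 by rewrite divr_gt0.
  have [f _ fg] := near_g _ e30.
  have /cvgrPdist_le/(_ _ e30) := @contfun_continuous _ _ _ _ f x.
  apply: filterS => y fxy.
  have -> : g x - g y = (g x - f x) + (f x - f y) + (f y - g y).
    by rewrite !addrA !subrK.
  have := ler_normD (g x - f x + (f x - f y)) (f y - g y).
  have := ler_normD (g x - f x) (f x - f y).
  have := fg x; rewrite distrC; have := fg y; move: fxy; lra.
have gP : g \in @continuous_pred X V by rewrite inE.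
apply/cvg_ex; exists (ContFun cX gP).
apply/(@cvgrPdist_le _ _ _ F _ id) => e e0.
have e20 : 0 < e / 2 by rewrite divr_gt0.
have [f Ff fg] := near_g _ e20; apply: filterS Ff => h.
rewrite -ball_normE /= => fh; apply: supnorm_le => [|x]; first exact: ltW.
have := fg x; rewrite distrC; have := le_lt_trans (dist_le f h x) fh.
have -> : (ContFun cX gP - h) x = (g x - f x) + (f x - h x).
  by rewrite addrA subrK.
by have := ler_normD (g x - f x) (f x - h x); lra.
Qed.

HB.instance Definition _ := Uniform_isComplete.Build C contfun_cauchy_cvg.

End contfun_complete.

Definition graph (T U : Type) (f : T -> U) : set (T * U) :=
  range (fun x => (x, f x)).

Section dimension.
Variables (R : realType) (T : metricType R).
Implicit Types A F : set T.
Local Open Scope ereal_scope.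

(* [0] is inserted so that the empty set has diameter [0]. *)
Definition diam A : \bar R :=
  ereal_sup (0 |` [set (mdist p.1 p.2)%:E | p in A `*` A]).

Definition hausdorff_premeasure (s d : R) A : \bar R :=
  ereal_inf [set \sum_(0 <= i <oo) poweR (diam (U i)) s | U in
    [set U : (set T)^nat |
      A `<=` \bigcup_i U i /\ forall i, diam (U i) <= d%:E]].

Definition hausdorff_measure (s : R) A : \bar R :=
  ereal_sup [set hausdorff_premeasure s d A | d in [set d : R | (0 < d)%R]].

(* Leaving out [s = 0] does not change the infimum, and makes the convention
   for [0 `^ 0] irrelevant. *)
Definition hausdorff_dim A : \bar R :=
  ereal_inf [set s%:E | s in
    [set s : R | (0 < s)%R /\ hausdorff_measure s A = 0]].

Definition has_cover (d : R) F (k : nat) : Prop :=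
  exists U : 'I_k -> set T,
    F `<=` \bigcup_i U i /\ forall i, diam (U i) <= d%:E.

Definition totally_bounded F : Prop :=
  forall d : R, (0 < d)%R -> exists k, has_cover d F k.

(* [+oo] if there is no finite cover. *)
Definition covering_number (d : R) F : \bar R :=
  ereal_inf [set k%:R%:E | k in [set k : nat | has_cover d F k]].

Definition upper_box_dim F : \bar R :=
  limf_esup (fun d : R => lne (covering_number d F) / (- ln d)%:E)
    (0%R : R)^'+.

Definition packing_dim F : \bar R :=
  ereal_inf [set ereal_sup (range (fun i => upper_box_dim (G i))) | G in
    [set G : (set T)^nat |
      F `<=` \bigcup_i G i /\ forall i, totally_bounded (G i)]].

End dimension.

Section prevalence.
Variables (R : realType) (E : completeNormedModType R).

Definition borel_set (B : set E) : Prop := <<s @open E >> B.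

Definition compactly_supported
    (mu : probability (g_sigma_algebraType (@open E)) R) : Prop :=
  exists2 K : set E, compact K & mu (~` K) = 0%E.

Definition shy_borel (B : set E) : Prop :=
  borel_set B /\
  exists2 mu : probability (g_sigma_algebraType (@open E)) R,
    compactly_supported mu &
    forall x : E, mu [set y + x | y in B] = 0%E.

(* A Borel subset of a shy Borel set is shy by monotonicity of the measure, so
   this covers Borel and non-Borel sets at once. *)
Definition shy (S : set E) : Prop := exists2 B, shy_borel B & S `<=` B.

Definition prevalent (S : set E) : Prop := shy (~` S).

End prevalence.

(* Main.v *)
(** Pick a Cantor set in X and functions phi_(i,0), phi_(i,1) : X -> R
    (i < n) reading off interleaved ternary digits on it, and perturb the
    i-th coordinate of a given g by t_(i,0) phi_(i,0) + t_(i,1) phi_(i,1),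
    the t's being independent and uniform on [0, 1]. The i-th coordinates at
    two points then lie within r of each other with probability at most
    2r / max_b |phi_(i,b)(x) - phi_(i,b)(y)|, and since two 1/3-Cantor
    digit functions per coordinate give dimension log 4 / log 3 > 1, the
    expected number of such close pairs among N = 4^(mn) points, with
    r = 4^-m, is O(N). Hence almost surely there are O(N) close pairs for
    infinitely many m. By Cauchy-Schwarz a cover of the graph by sets of
    diameters d_k, cut into cells of side r, must have sum d_k^n bounded
    below, so dim_H G_f >= n. The upper bounds hold for every f: over a set
    of diameter d, the graph is covered by O(d^-n) sets of diameter O(d). *)

Require Import Defs.
From HB Require Import structures.
From mathcomp Require Import all_boot all_order all_algebra.
From mathcomp Require Import all_classical all_reals all_analysis.
From mathcomp Require Import measurable_realfun.
From mathcomp Require Import ring lra.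

Import Order.TTheory GRing.Theory Num.Theory.
Import numFieldNormedType.Exports.

Local Open Scope classical_set_scope.
Local Open Scope ring_scope.

Set Implicit Arguments.
Unset Strict Implicit.
Unset Printing Implicit Defensive.

(** * Premeasures, covering numbers and null sets *)

Section hausdorff.
Variables (R : realType) (T : metricType R).
Implicit Types (A F : set T) (s d : R).
Local Open Scope ereal_scope.

(** Digits are read in base 3 because of cancellation: in base 2 the later digits could undo a
    difference at the first place where two points disagree, whereas here they undo at most half of
    it. The price is that one digit function only has dimension log 2 / log 3 < 1, hence two per
    coordinate. Each further agreeing letter then multiplies the probability bound by 3 but divides
    the number of words by 4, so the sum over words is geometric: the bound O(N) carries no
    logarithm, and n is reached without losing an epsilon.

    The obstacle is that prevalence asks for a Borel exceptional set and a bound for every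
    translate. The first is met by excluding a set defined through counts of close pairs, not
    through dimension. The second is met because the probability that a random affine expression
    lies in [-r, r] has a bound independent of the constant term, which absorbs the translate. The
    measure is the law of a random point in a compact part of the span of 2n functions.

    Infinitely many good m suffice: compactness turns a cover of the graph into finitely many balls,
    and a single scale r below all their radii gives the contradiction. *)

Lemma diam_ge0 A : 0 <= diam A.
Proof. by apply: ereal_sup_ubound; left. Qed.

Lemma diam_le A (d : \bar R) : 0 <= d ->
  (forall x y, A x -> A y -> (mdist x y)%:E <= d) -> diam A <= d.
Proof.
move=> d0 Ad; apply: ge_ereal_sup => _ [->//|[[x y] [/= Ax Ay] <-]].
exact: Ad.
Qed.

Lemma le_diam A x y : A x -> A y -> (mdist x y)%:E <= diam A.
Proof. by move=> Ax Ay; apply: ereal_sup_ubound; right; exists (x, y). Qed.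

Lemma diam0 : diam (set0 : set T) = 0.
Proof.
by apply/eqP; rewrite eq_le diam_ge0 andbT; apply: diam_le => // x y [].
Qed.

Lemma premeasure_ge0 s d A : 0 <= hausdorff_premeasure s d A.
Proof.
apply: le_ereal_inf_tmp => _ [U _ <-].
by apply: nneseries_ge0 => i _ _; exact: poweR_ge0.
Qed.

Lemma premeasure_le s d A (U : (set T)^nat) : A `<=` \bigcup_i U i ->
  (forall i, diam (U i) <= d%:E) ->
  hausdorff_premeasure s d A <= \sum_(0 <= i <oo) poweR (diam (U i)) s.
Proof. by move=> AU dU; apply: ereal_inf_lbound; exists U. Qed.

Lemma premeasure_lt s d A (e : \bar R) : hausdorff_premeasure s d A < e ->
  exists U : (set T)^nat, [/\ A `<=` \bigcup_i U i,
    forall i, diam (U i) <= d%:E &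
    \sum_(0 <= i <oo) poweR (diam (U i)) s < e].
Proof. by move/ereal_inf_lt => [_ [U [AU dU] <-] h]; exists U. Qed.

Lemma premeasure_subset s d A F : A `<=` F ->
  hausdorff_premeasure s d A <= hausdorff_premeasure s d F.
Proof.
move=> AF; apply: ereal_inf_le_tmp => _ [U [FU dU] <-].
by exists U => //; split=> //; exact: subset_trans FU.
Qed.

(** Near-optimal covers of the pieces, with errors e / 2^(n+1), merge into one cover at the same
    scale [d]; the double series of nonnegative terms is flattened along a bijection of [nat] with
    [nat * nat]. A piece of infinite premeasure is split off because it has no near-optimal
    cover. *)
Lemma premeasure_sigma_subadditive s d (A : (set T)^nat) :
  hausdorff_premeasure s d (\bigcup_i A i)
    <= \sum_(0 <= i <oo) hausdorff_premeasure s d (A i).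
Proof.
have [[i ioo]|] := pselect (exists i, hausdorff_premeasure s d (A i) = +oo).
  rewrite (eseries_pinfty _ _ ioo) ?leey// => n _.
  by rewrite -ltNye (lt_le_trans _ (premeasure_ge0 _ _ _)).
rewrite -forallNE => Aoo; apply/lee_addgt0Pr => e e0.
apply: le_trans (epsilon_trick _ _ (ltW e0)); last first.
  by move=> n; exact: premeasure_ge0.
have /choice[G PG] n : exists U : (set T)^nat, [/\ A n `<=` \bigcup_i U i,
    forall i, diam (U i) <= d%:E &
    \sum_(0 <= i <oo) poweR (diam (U i)) s
      <= hausdorff_premeasure s d (A n) + (e / (2 ^ n.+1)%:R)%:E].
  have : hausdorff_premeasure s d (A n) <
      hausdorff_premeasure s d (A n) + (e / (2 ^ n.+1)%:R)%:E.
    rewrite lteDl; first by rewrite lte_fin divr_gt0// ltr0n expn_gt0.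
    by rewrite ge0_fin_numE ?premeasure_ge0// ltey; apply/eqP.
  by move/premeasure_lt => [U [? ? h]]; exists U; split=> //; exact: ltW.
apply: (@le_trans _ _
    (\sum_(0 <= i <oo) \sum_(0 <= j <oo) poweR (diam (G i j)) s)); last first.
  apply: lee_nneseries => [i _ _|i _]; last by have [] := PG i.
  by apply: nneseries_ge0 => j _ _; exact: poweR_ge0.
have g0 (k : nat * nat) : 0 <= poweR (diam (G k.1 k.2)) s.
  exact: poweR_ge0.
have -> : \sum_(0 <= i <oo) \sum_(0 <= j <oo) poweR (diam (G i j)) s =
    \esum_(k in [set: nat * nat]) poweR (diam (G k.1 k.2)) s.
  transitivity (\esum_(i in [set: nat]) \esum_(j in [set: nat])
      poweR (diam (G i j)) s).
    rewrite nneseries_esumT; last first.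
      by move=> i; apply: nneseries_ge0 => j _ _; exact: poweR_ge0.
    apply: eq_esum => i _; rewrite nneseries_esumT// => j.
    exact: poweR_ge0.
  rewrite esum_esum; last by move=> *; exact: poweR_ge0.
  by congr esum; apply/seteqP; split.
have /card_esym/ppcard_eqP[f] := card_nat2.
rewrite (@reindex_esum _ _ _ [set: nat] _ f)//.
rewrite -(nneseries_esumT (a := fun i => poweR (diam (G (f i).1 (f i).2)) s));
  last by move=> i; exact: g0.
apply: (@premeasure_le s d _ (fun i => G (f i).1 (f i).2)); last first.
  by move=> i; have [_ + _] := PG (f i).1; apply.
move=> t [i _ At]; have [AG _ _] := PG i.
have [j _ Gt] := AG _ At; exists (f^-1%FUN (i, j)) => //=.
by rewrite invK ?inE.
Qed.

Lemma premeasure_finite s d' d A k : (0 < s)%R -> (0 <= d' <= d)%R ->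
  has_cover d' A k ->
  hausdorff_premeasure s d A <= (k%:R * d' `^ s)%:E.
Proof.
move=> s0 /andP[d0 dd] [U [AU dU]].
(* The finite cover is padded with empty sets, which cost nothing since [0 < s]. *)
pose V (i : nat) := if insub i is Some j then U j else set0.
have Vk i : (k <= i)%N -> V i = set0.
  by move=> ki; rewrite /V insubN// -leqNgt.
apply: le_trans (@premeasure_le s d _ V _ _) _.
- move=> t /AU[i _ Ut]; exists (val i) => //.
  by rewrite /V valK.
- move=> i; rewrite /V; case: insubP => [j _ _|_]; last first.
    by rewrite diam0 lee_fin (le_trans d0).
  by apply: le_trans (dU j) _; rewrite lee_fin.
rewrite (nneseries_split 0 k); last by move=> *; exact: poweR_ge0.
rewrite add0n [X in _ + X]eseries0 ?adde0; last first.
  by move=> i ki _; rewrite Vk// diam0 poweR0r// gt_eqF.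
rewrite big_mkord.
apply: (@le_trans _ _ (\sum_(i < k) (d' `^ s)%:E)); last first.
  by rewrite sumEFin lee_fin sumr_const card_ord mulr_natl.
apply: lee_sum => i _; rewrite /V valK -poweR_EFin.
apply: gt0_ler_poweR; rewrite ?(ltW s0)//.
  by rewrite in_itv/= diam_ge0 leey.
by rewrite in_itv/= lee_fin d0 leey.
Qed.

Lemma hausdorff_measure_eq0P s A : hausdorff_measure s A = 0 <->
  (forall d, (0 < d)%R -> hausdorff_premeasure s d A = 0).
Proof.
split=> [h d d0|h].
  apply/eqP; rewrite eq_le premeasure_ge0 andbT -h.
  by apply: ereal_sup_ubound; exists d.
apply/eqP; rewrite eq_le; apply/andP; split.
  by apply: ge_ereal_sup => _ [d /h d0 <-]; rewrite d0.
apply: le_ereal_sup_tmp; exists (hausdorff_premeasure s 1 A).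
  by exists 1%R => //=; exact: ltr01.
exact: premeasure_ge0.
Qed.

Lemma hausdorff_null_bigcup s (A : (set T)^nat) :
  (forall i, hausdorff_measure s (A i) = 0) ->
  hausdorff_measure s (\bigcup_i A i) = 0.
Proof.
move=> A0; apply/hausdorff_measure_eq0P => d d0.
apply/eqP; rewrite eq_le premeasure_ge0 andbT.
apply: le_trans (premeasure_sigma_subadditive _ _ _) _.
by rewrite eseries0// => i _ _; have /hausdorff_measure_eq0P := A0 i; apply.
Qed.

Lemma hausdorff_null_subset s A F : A `<=` F ->
  hausdorff_measure s F = 0 -> hausdorff_measure s A = 0.
Proof.
move=> AF /hausdorff_measure_eq0P F0; apply/hausdorff_measure_eq0P => d d0.
by apply/eqP; rewrite eq_le premeasure_ge0 andbT -(F0 d d0) premeasure_subset.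
Qed.

Lemma hausdorff_dim_ge0 A : 0 <= hausdorff_dim A.
Proof. by apply: le_ereal_inf_tmp => _ [s [/ltW s0 _] <-]; rewrite lee_fin. Qed.

Lemma hausdorff_dim_le A s : (0 < s)%R -> hausdorff_measure s A = 0 ->
  hausdorff_dim A <= s%:E.
Proof. by move=> s0 As; apply: ereal_inf_lbound; exists s. Qed.

Lemma hausdorff_dim_lt A (e : \bar R) : hausdorff_dim A < e ->
  exists s, [/\ (0 < s)%R, s%:E < e & hausdorff_measure s A = 0].
Proof. by move/ereal_inf_lt => [_ [s [s0 As] <-] se]; exists s. Qed.

Lemma covering_number_le d F k : has_cover d F k ->
  covering_number d F <= k%:R%:E.
Proof. by move=> Fk; apply: ereal_inf_lbound; exists k. Qed.

Lemma covering_number_attained d F : covering_number d F < +oo ->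
  exists2 k, has_cover d F k & covering_number d F = k%:R%:E.
Proof.
move/ereal_inf_lt => [_ [k0 Fk0 _] _].
have /ex_minnP[k /asboolP Fk mk] : exists k, `[<has_cover d F k>].
  by exists k0; apply/asboolP.
exists k => //; apply/eqP; rewrite eq_le covering_number_le//=.
apply: le_ereal_inf_tmp => _ [j Fj <-]; rewrite lee_fin ler_nat.
by apply: mk; apply/asboolP.
Qed.

(** This lemma and [upper_box_dim_lt] trade the upper limit of logarithmic quotients for plain
    counting bounds at all small scales, the form in which box dimension is used below. *)
Lemma upper_box_dim_le F (t : R) :
  (\forall d \near (0%R : R)^'+, exists2 k, has_cover d F k &
    (k%:R <= d `^ (- t))%R) ->
  upper_box_dim F <= t%:E.
Proof.
move=> h; have h1 : \forall d \near (0%R : R)^'+, (0 < d < 1)%R.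
  near=> d; apply/andP; split; first by near: d; exact: nbhs_right_gt.
  by near: d; exact: nbhs_right_lt.
pose V := [set d : R | (exists2 k, has_cover d F k &
    (k%:R <= d `^ (- t))%R) /\ (0 < d < 1)%R].
have hV : nbhs ((0%R : R)^'+) V by apply: filterI.
apply: ge_ereal_inf; exists (ereal_sup ((fun d : R =>
  lne (covering_number d F) / (- ln d)%:E) @` V)); first by exists V.
apply: ge_ereal_sup => _ [d [[k Fk kd] /andP[d0 d1]] <-].
have ld : (0 < - ln d)%R by rewrite oppr_gt0 ln_lt0// d0 d1.
rewrite inver gt_eqF// lee_pdivrMr//.
have cn := covering_number_le Fk.
move: (covering_number d F) cn => [r| |]//= rk.
  case: ifPn => r0.
    rewrite leNye//.
  rewrite -EFinM lee_fin -ler_expR lnK ?posrE ?ltNge//.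
  apply: (@le_trans _ _ (d `^ (- t))%R); first exact: le_trans kd.
  by rewrite /powR gt_eqF// mulrN mulNr.
by rewrite leNye.
Unshelve. all: by end_near. Qed.

Lemma upper_box_dim_lt F (t : R) : upper_box_dim F < t%:E ->
  \forall d \near (0%R : R)^'+, exists2 k, has_cover d F k &
    (k%:R <= d `^ (- t))%R.
Proof.
move/ereal_inf_lt => [_ [V V0 <-] Vt]; near=> d.
have d0 : (0 < d)%R by near: d; exact: nbhs_right_gt.
have d1 : (d < 1)%R by near: d; exact: nbhs_right_lt.
have ld : (0 < - ln d)%R by rewrite oppr_gt0 ln_lt0// d0 d1.
have : lne (covering_number d F) / (- ln d)%:E < t%:E.
  apply: le_lt_trans Vt; apply: ereal_sup_ubound; exists d => //.
  by near: d.
rewrite inver gt_eqF// lte_pdivrMr// => h.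
have [cy|cy] := ltP (covering_number d F) +oo; last first.
  by move: cy h; rewrite leye_eq => /eqP ->.
have [k Fk ck] := covering_number_attained cy; exists k => //.
move: h; rewrite ck /= lern0; case: k {Fk ck} => [_|k]; first exact: powR_ge0.
rewrite -EFinM lte_fin => /ltW; rewrite -ler_expR lnK ?posrE//.
by rewrite /powR gt_eqF// mulrN mulNr.
Unshelve. all: by end_near. Qed.
End hausdorff.

Section real_facts.
Variable R : realType.

Lemma powRD_gt0 (a x y : R) : 0 < a -> a `^ (x + y) = a `^ x * a `^ y.
Proof. by move=> a0; rewrite powRD// (gt_eqF a0) implybT. Qed.

(** The key is the vector of integer parts of (u_i - c_i) / d. Its fibres serve as covering sets for
    the upper bounds and as pigeonholes for the lower bound. *)
Lemma grid_partition (n : nat) (c : 'I_n -> R) (L d : R) : 0 <= L -> 0 < d ->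
  exists key : ('I_n -> R) -> {ffun 'I_n -> 'I_(Num.trunc (L / d)).+1},
    forall u v, (forall i, c i <= u i <= c i + L) ->
      (forall i, c i <= v i <= c i + L) ->
      key u = key v -> forall i, `|u i - v i| <= d.
Proof.
move=> L0 d0; pose cell (u : 'I_n -> R) i := Num.trunc ((u i - c i) / d).
exists (fun u => [ffun i => inord (cell u i)]) => u v cu cv /ffunP uv i.
have cellP w : (forall i, c i <= w i <= c i + L) ->
    [/\ (cell w i < (Num.trunc (L / d)).+1)%N,
        (cell w i)%:R * d <= w i - c i & w i - c i <= (cell w i)%:R * d + d].
  move=> /(_ i)/andP[c1 c2].
  have w0 : 0 <= (w i - c i) / d by rewrite divr_ge0 ?(ltW d0)// subr_ge0.
  have /andP[t1 t2] := truncn_itv w0.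
  split.
  - rewrite ltnS; apply: le_truncn; rewrite ler_pM2r ?invr_gt0//; lra.
  - by rewrite -ler_pdivlMr.
  - by move: t2; rewrite ltr_pdivrMr// -natr1 mulrDl mul1r => /ltW.
have [u1 u2 u3] := cellP u cu; have [v1 v2 v3] := cellP v cv.
have := uv i; rewrite !ffunE => /(congr1 val); rewrite /= !inordK// => e.
rewrite e in u2 u3; rewrite ler_norml; apply/andP; split; lra.
Qed.

Lemma trunc_div_le (L d : R) : 0 <= L -> 0 < d <= 1 ->
  (Num.trunc (L / d)).+1%:R <= (L + 1) / d.
Proof.
move=> L0 /andP[d0 d1]; rewrite -natr1 mulrDl lerD//.
  by rewrite truncn_le divr_ge0// ltW.
by rewrite mul1r -invr1 lef_pV2 ?posrE.
Qed.

End real_facts.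

(** * Upper bounds for the dimensions of a graph *)

Section graph_dimension.
Variables (R : realType) (X : metricType R) (n : nat).
Hypothesis n_gt0 : (0 < n)%N.
Variables (f : X -> eucl R n) (M : R).
Hypothesis M0 : 0 <= M.
Hypothesis fM : forall x i, `|(f x : 'rV[R]_n) 0 i| <= M.
Implicit Types (A : set X) (d s t : R).

Let gr A : set (X * eucl R n) := [set (x, f x) | x in A].

Let n1 : 1 <= n%:R :> R. Proof. by rewrite ler1n. Qed.

Lemma has_cover_finType (T : metricType R) (I : finType) d (F : set T)
    (U : I -> set T) :
  F `<=` \bigcup_i U i -> (forall i, (diam (U i) <= d%:E)%E) ->
  has_cover d F #|I|.
Proof.
move=> FU dU; exists (fun j => U (enum_val j)); split=> [x /FU[i _ Ux]|j].
  by exists (enum_rank i) => //; rewrite enum_rankK.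
exact: dU.
Qed.

(** Each covering set is split according to the grid cell of side [d] that contains the value of
    [f]. The factor [n] comes from bounding the Euclidean norm by [n] times the largest
    coordinate. *)
Lemma has_cover_graph d A k : 0 < d -> has_cover d A k ->
  has_cover (n%:R * d) (gr A) (k * (Num.trunc (2 * M / d)).+1 ^ n).
Proof.
move=> d0 [U [AU dU]].
have M2 : 0 <= 2 * M by rewrite mulr_ge0.
have [key keyP] := @grid_partition R n (fun=> - M) (2 * M) d M2 d0.
have fb x i : - M <= (f x : 'rV[R]_n) 0 i <= - M + 2 * M.
  by have := fM x i; rewrite ler_norml => /andP[? ?]; apply/andP; split; lra.
pose k' x := key (fun i => (f x : 'rV[R]_n) 0 i).
have := @has_cover_finType (X * eucl R n)%type
  ('I_k * {ffun 'I_n -> 'I_(Num.trunc (2 * M / d)).+1})%type (n%:R * d) (gr A)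
  (fun p => [set (x, f x) | x in [set x | U p.1 x /\ k' x = p.2]]).
rewrite card_prod card_ffun !card_ord; apply.
  move=> _ [x /AU[i _ Ux] <-]; exists (i, k' x) => //=.
  by exists x.
move=> [i c] /=; apply: diam_le; first by rewrite lee_fin mulr_ge0// (ltW d0).
move=> _ _ [x [Ux kx] <-] [y [Uy ky] <-]; rewrite lee_fin ge_max; apply/andP; split.
  rewrite -lee_fin; apply: le_trans (le_diam Ux Uy) _.
  by apply: le_trans (dU i) _; rewrite lee_fin ler_peMl// (ltW d0).
apply: enorm_le (ltW d0) _ => j.
have := keyP _ _ (fb x) (fb y) (etrans kx (esym ky)) j.
by rewrite !mxE.
Qed.

Let C : R := (2 * M + 1) ^+ n.

Let C_ge1 : 1 <= C.
Proof. by rewrite /C exprn_ege1// lerDr mulr_ge0. Qed.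

Let C_gt0 : 0 < C. Proof. exact: lt_le_trans C_ge1. Qed.

Let cells_le d : 0 < d <= 1 ->
  (((Num.trunc (2 * M / d)).+1 ^ n)%N%:R <= C / d ^+ n).
Proof.
move=> d01; have M2 : 0 <= 2 * M by rewrite mulr_ge0.
have h := trunc_div_le M2 d01.
rewrite natrX -expr_div_n lerXn2r ?nnegrE//.
exact: le_trans h.
Qed.

(** There are at most C e^-n cells, each costing (n e)^(s+n), so the powers e^n cancel and only e^s
    remains. *)
Lemma premeasure_graph_le s d e A : 0 < s -> 0 < e <= 1 -> n%:R * e <= d ->
  (diam A <= e%:E)%E ->
  (hausdorff_premeasure (s + n%:R) d (gr A)
    <= (C * n%:R `^ (s + n%:R) * e `^ s)%:E)%E.
Proof.
move=> s0 /andP[e0 e1] ned Ae.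
have A1 : has_cover e A 1.
  by exists (fun=> A); split=> // x Ax; exists ord0.
apply: le_trans (premeasure_finite _ _ (has_cover_graph e0 A1)) _.
- by rewrite addr_gt0// ltr0n.
- by rewrite mulr_ge0//= ltW.
rewrite mul1n lee_fin powRM ?(ltW e0)// !powRD_gt0// ?ltr0n//.
rewrite (powR_mulrn n (ltW e0)).
have := @cells_le e; rewrite e0 e1 => /(_ isT).
set N := (X in X <= _); rewrite ler_pdivlMr ?exprn_gt0// => NC.
set P := _ * _ `^ n%:R; have P0 : 0 <= P by rewrite mulr_ge0 ?powR_ge0.
have -> : N * (P * (e `^ s * e ^+ n)) = (N * e ^+ n) * (P * e `^ s) by ring.
have -> : C * P * e `^ s = C * (P * e `^ s) by ring.
by rewrite ler_wpM2r// mulr_ge0// powR_ge0.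
Qed.

Lemma hausdorff_null_graph s : 0 < s -> hausdorff_measure s [set: X] = 0%E ->
  hausdorff_measure (s + n%:R) (graph f) = 0%E.
Proof.
move=> s0 /hausdorff_measure_eq0P X0; apply/hausdorff_measure_eq0P => d d0.
pose D := C * n%:R `^ (s + n%:R).
have D0 : 0 < D by rewrite mulr_gt0// powR_gt0// ltr0n.
(* The bound 1 is needed to count cells, and d / n keeps the pieces of the graph below diameter
   [d]. *)
pose e := Num.min 1 (d / n%:R).
have e0 : 0 < e by rewrite lt_min ltr01 divr_gt0// ltr0n.
have e1 : e <= 1 by rewrite ge_min lexx.
have ned : n%:R * e <= d.
  by rewrite mulrC -ler_pdivlMr ?ltr0n// ge_min lexx orbT.
apply/eqP; rewrite eq_le premeasure_ge0 andbT; apply/lee_addgt0Pr => b b0.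
rewrite add0e.
have bD : 0 < b / D by rewrite divr_gt0.
have := X0 _ e0.
have : (0 < (b / D)%:E :> \bar R)%E by rewrite lte_fin.
move=> /[swap] <- /premeasure_lt[U [XU dU Ub]].
have -> : graph f = \bigcup_i gr (U i).
  apply/seteqP; split=> [_ [x _ <-]|_ [i _ [x _ <-]]]; last by exists x.
  by have [i _ Ux] := XU x I; exists i => //; exists x.
apply: le_trans (premeasure_sigma_subadditive _ _ _) _.
apply: (@le_trans _ _ (\sum_(0 <= i <oo) D%:E * poweR (diam (U i)) s)%E).
  apply: lee_nneseries => [i _ _|i _]; first exact: premeasure_ge0.
  have := dU i; have := diam_ge0 (U i).
  move dUi : (diam (U i)) => [r| |]//; rewrite !lee_fin => r0 re.
  have [r0'|r0'] := eqVneq r 0; last first.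
    have {}r0 : 0 < r by rewrite lt_neqAle eq_sym r0'.
    rewrite -EFinM; apply: premeasure_graph_le => //.
    - by rewrite r0 (le_trans re).
    - by apply: le_trans ned; rewrite ler_wpM2l.
    - by rewrite dUi.
  (* A set of diameter 0 costs nothing in [X], but the cell estimate wants a positive scale: [q] is
     taken so small that D q^s is at most the arbitrary [a]. *)
  rewrite r0' poweR0r ?gt_eqF// mule0; apply/lee_addgt0Pr => a a0; rewrite add0e.
  pose q := Num.min e ((a / D) `^ s^-1).
  have aD : 0 < a / D by rewrite divr_gt0.
  have q0 : 0 < q by rewrite lt_min e0 powR_gt0.
  have qe : q <= e by rewrite ge_min lexx.
  apply: (@le_trans _ _ (D * q `^ s)%:E).
    apply: premeasure_graph_le => //.
    - by rewrite q0 (le_trans qe).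
    - by apply: le_trans ned; rewrite ler_wpM2l.
    - by rewrite dUi lee_fin r0' ltW.
  rewrite lee_fin mulrC -ler_pdivlMr//.
  have -> : a / D = ((a / D) `^ s^-1) `^ s.
    by rewrite -powRrM mulVf ?gt_eqF// powRr1// ltW.
  apply: ge0_ler_powR; rewrite ?nnegrE ?powR_ge0 ?(ltW s0) ?(ltW q0)//.
  by rewrite ge_min lexx orbT.
rewrite nneseriesZl; last by move=> i _; exact: poweR_ge0.
rewrite -lee_pdivlMl// -EFinM.
by rewrite mulrC ltW.
Qed.

Lemma hausdorff_dim_graph_le :
  (hausdorff_dim (graph f) <= hausdorff_dim [set: X] + n%:R%:E)%E.
Proof.
apply/lee_addgt0Pr => e e0.
have [Xy|Xy] := eqVneq (hausdorff_dim [set: X]) +oo%E.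
  by rewrite Xy !addye ?leey.
have Xfin : hausdorff_dim [set: X] \is a fin_num.
  by rewrite ge0_fin_numE ?hausdorff_dim_ge0// ltey.
have : (hausdorff_dim [set: X] < hausdorff_dim [set: X] + e%:E)%E.
  by rewrite lteDl// lte_fin.
move/hausdorff_dim_lt => [s [s0 sX Xs]].
apply: (@le_trans _ _ (s + n%:R)%:E).
  apply: hausdorff_dim_le; first by rewrite addr_gt0// ltr0n.
  exact: hausdorff_null_graph.
by rewrite EFinD addeAC leeD2r// ltW.
Qed.

(** Covering [A] at scale d / n yields graph pieces of diameter at most [d]; the gap u - t absorbs
    the constant, since K d^(u-t) <= 1 for small [d]. *)
Lemma upper_box_dim_graph_le t u A : t < u -> (upper_box_dim A < t%:E)%E ->
  (upper_box_dim (gr A) <= (u + n%:R)%:E)%E.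
Proof.
move=> tu /upper_box_dim_lt At; apply: upper_box_dim_le.
pose K := C * n%:R `^ (t + n%:R).
have K0 : 0 < K by rewrite mulr_gt0// powR_gt0// ltr0n.
have n0 : 0 < n%:R :> R by rewrite ltr0n.
have {}At : \forall d \near (0 : R)^'+, exists2 k, has_cover (d / n%:R) A k &
    k%:R <= (d / n%:R) `^ (- t).
  have cn : (fun d : R => d / n%:R) @ (0 : R)^'+ --> (0 : R)^'+.
    move=> V [e /= e0 eV]; exists (e * n%:R); first by rewrite /= mulr_gt0.
    move=> d /= de d0; apply: eV => /=; last by rewrite divr_gt0.
    by move: de; rewrite !sub0r !normrN normrM normfV (gtr0_norm n0) ltr_pdivrMr.
  exact: (cn _ At).
have ut0 : 0 < u - t by rewrite subr_gt0.
have Kd : \forall d \near (0 : R)^'+, d `^ (u - t) <= K^-1.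
  have := powR_cvg0 ut0 => /cvgrPdist_le/(_ K^-1); rewrite invr_gt0 => /(_ K0).
  by apply: filterS => d; rewrite sub0r normrN ger0_norm ?powR_ge0.
near=> d.
have d0 : 0 < d by near: d; exact: nbhs_right_gt.
have d1 : d <= 1 by near: d; exact: nbhs_right_le.
have [k Ak kd] : exists2 k, has_cover (d / n%:R) A k &
    k%:R <= (d / n%:R) `^ (- t) by near: d.
have e0 : 0 < d / n%:R by rewrite divr_gt0.
have e1 : d / n%:R <= 1 by rewrite ler_pdivrMr// mul1r (le_trans d1).
have := has_cover_graph e0 Ak; rewrite mulrCA divff ?gt_eqF// mulr1 => h.
eexists; first exact: h.
rewrite natrM; apply: (@le_trans _ _ ((d / n%:R) `^ (- t) * (C / (d / n%:R) ^+ n))).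
  by apply: ler_pM => //; apply: cells_le; rewrite e0.
rewrite -(powR_mulrn n (ltW e0)) -powRN mulrCA -powRD_gt0// -opprD.
rewrite powRM ?invr_ge0 ?(ltW d0) ?(ltW n0)//.
have -> : n%:R^-1 `^ (- (t + n%:R)) = n%:R `^ (t + n%:R) :> R.
  by rewrite -powR_inv1 ?(ltW n0)// -powRrM mulN1r opprK.
rewrite (_ : C * _ = K * d `^ (- (t + n%:R))); last by rewrite /K; ring.
have -> : - (u + n%:R) = - (u - t) + - (t + n%:R) by ring.
rewrite (powRD_gt0 (- (u - t)))// ler_wpM2r ?powR_ge0// powRN -[K]invrK.
rewrite lef_pV2 ?posrE ?invr_gt0 ?powR_gt0//.
by near: d.
Unshelve. all: by end_near. Qed.

Lemma packing_dim_graph_le t : (packing_dim [set: X] < t%:E)%E ->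
  (packing_dim (graph f) <= (t + n%:R)%:E)%E.
Proof.
move=> /ereal_inf_lt[_ [G [XG tG] <-] Gt].
have [r [Gr rt]] : exists r : R, (ereal_sup (range (fun i => upper_box_dim (G i)))
    < r%:E)%E /\ r < t.
  move: Gt; case: ereal_sup => [r| |]//.
    rewrite lte_fin => rt; exists ((r + t) / 2); rewrite lte_fin; split; lra.
  by move=> _; exists (t - 1); rewrite ltNyr; split=> //; lra.
apply: ge_ereal_inf; exists (ereal_sup (range (fun i => upper_box_dim (gr (G i))))).
  exists (fun i => gr (G i)) => //; split=> [_ [x _ <-]|i d d0].
    by have [i _ Gx] := XG x I; exists i => //; exists x.
  have e0 : 0 < d / n%:R by rewrite divr_gt0// ltr0n.
  have [k Gk] := tG i _ e0; have := has_cover_graph e0 Gk.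
  by rewrite mulrCA divff ?gt_eqF ?ltr0n// mulr1 => ?; eexists; eassumption.
apply: ge_ereal_sup => _ [i _ <-]; apply: upper_box_dim_graph_le rt _.
by apply: le_lt_trans Gr; apply: ereal_sup_ubound; exists i.
Qed.

End graph_dimension.

(* The hypothesis [0 < t] excludes the empty set, whose packing dimension is
   [-oo]. *)
Lemma hausdorff_dim_le_packing (R : realType) (T : metricType R) (F : set T)
    (t : R) : 0 < t -> (packing_dim F < t%:E)%E ->
  (hausdorff_dim F <= t%:E)%E.
Proof.
move=> t0 /ereal_inf_lt[_ [G [FG tG] <-] Gt]; apply: hausdorff_dim_le => //.
apply: hausdorff_null_subset FG _; apply: hausdorff_null_bigcup => i.
have {}Gt : (upper_box_dim (G i) < t%:E)%E.
  by apply: le_lt_trans Gt; apply: ereal_sup_ubound; exists i.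
have [r [Gr rt]] : exists r : R, (upper_box_dim (G i) < r%:E)%E /\ r < t.
  move: Gt; case: upper_box_dim => [r| |]//.
    rewrite lte_fin => rt; exists ((r + t) / 2); rewrite lte_fin; split; lra.
  by move=> _; exists (t - 1); rewrite ltNyr; split=> //; lra.
apply/hausdorff_measure_eq0P => d d0.
apply/eqP; rewrite eq_le premeasure_ge0 andbT; apply/lee_addgt0Pr => b b0.
rewrite add0e.
have tr0 : 0 < t - r by rewrite subr_gt0.
have bd : \forall e \near (0 : R)^'+, e `^ (t - r) <= b.
  have := powR_cvg0 tr0 => /cvgrPdist_le/(_ b b0).
  by apply: filterS => e; rewrite sub0r normrN ger0_norm ?powR_ge0.
near (0 : R)^'+ => e.
have e0 : 0 < e by near: e; exact: nbhs_right_gt.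
have ed : e <= d by near: e; exact: nbhs_right_le.
have [k Gk ke] : exists2 k, has_cover e (G i) k & k%:R <= e `^ (- r).
  by near: e; exact: upper_box_dim_lt.
apply: le_trans (premeasure_finite t0 _ Gk) _; first by rewrite ltW.
rewrite lee_fin; apply: (@le_trans _ _ (e `^ (- r) * e `^ t)).
  by rewrite ler_wpM2r ?powR_ge0.
by rewrite -powRD_gt0// addrC; near: e.
Unshelve. all: by end_near. Qed.

Lemma compact_finite_subcover (T : topologicalType) (K : set T)
    (O : T -> set T) : compact K -> (forall p, K p -> nbhs p (O p)) ->
  exists2 s : seq T, (forall p, p \in s -> K p) &
    forall x, K x -> exists2 p, p \in s & O p x.
Proof.
move=> /compact_near_coveringP cK KO.
(* The filter of properties shared by all sufficiently large finite lists of points of [K].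
   Near-covering compactness for this filter produces one list that works for every point at
   once. *)
pose F : set_system (seq T) := [set S : set (seq T) | exists2 l0 : seq T,
  (forall p, p \in l0 -> K p) &
  forall l, {subset l0 <= l} -> (forall p, p \in l -> K p) -> S l].
have FF : Filter F.
  split; first by exists [::].
  - move=> P Q [l1 K1 P1] [l2 K2 Q2]; exists (l1 ++ l2).
      by move=> p; rewrite mem_cat => /orP[/K1|/K2].
    move=> l l12 Kl; split; [apply: P1 Kl|apply: Q2 Kl] => p pl; apply: l12;
      by rewrite mem_cat pl ?orbT.
  - by move=> P Q PQ [l0 K0 P0]; exists l0 => // l l0l Kl; apply/PQ/P0.
have [|l0 K0] := cK _ F (fun l x => exists2 p, p \in l & O p x) FF.
  move=> p Kp; exists (O p, [set l : seq T | p \in l]) => /=; last first.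
    by move=> [x l] /= [Ox pl]; exists p.
  split; first exact: KO.
  exists [:: p]; first by move=> q; rewrite inE => /eqP ->.
  by move=> l sl _; apply: sl; rewrite inE eqxx.
by move=> /(_ l0 (fun=> id) K0) h; exists l0.
Qed.

(** * A Cantor scheme in an uncountable compact metric space *)

Section cantor_scheme.
Variables (R : realType) (X : metricType R).
Hypothesis cX : compact [set: X].
Implicit Types (A K : set X) (p q : X).

Lemma mdist_continuous p : continuous (mdist p : X -> R).
Proof.
move=> x; apply/cvgrPdist_lt => e e0.
have : nbhs x (ball x e) by exact: nbhsx_ballx.
apply: filterS => y; rewrite ballEmdist /= => xy.
have := metric_triangle p x y; have := metric_triangle p y x.
rewrite (metric_sym y x) => h1 h2.
by apply: le_lt_trans xy; rewrite ler_norml; apply/andP; split; lra.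
Qed.

Let closed_mdist_le p e : closed [set x | mdist p x <= e].
Proof.
have /continuous_closedP := @mdist_continuous p.
by move=> /(_ _ (@closed_le _ e)).
Qed.

Let closed_mdist_ge p e : closed [set x | e <= mdist p x].
Proof.
have /continuous_closedP := @mdist_continuous p.
by move=> /(_ _ (@closed_ge _ e)).
Qed.

Let closed_is_compact A : closed A -> compact A.
Proof. by move=> cA; apply: subclosed_compact cX _. Qed.

Lemma countable_near_compact A K : compact K ->
  (forall p, K p -> exists2 e : R, 0 < e & countable (A `&` ball p e)) ->
  countable (A `&` K).
Proof.
move=> cK h.
have /choice[e he] p : exists e : R, K p ->
    0 < e /\ countable (A `&` ball p e).
  have [Kp|nKp] := pselect (K p); last by exists 0.
  by have [e e0 ce] := h p Kp; exists e.
have [|s Ks sK] := @compact_finite_subcover _ K (fun p => ball p (e p)) cK.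
  by move=> p /he[e0 _]; exact: nbhsx_ballx.
have : countable (\bigcup_(p in [set` s]) (A `&` ball p (e p))).
  apply: bigcup_countable => [|p ps]; last by have [] := he p (Ks p ps).
  exact/finite_set_countable/finite_seq.
apply: sub_countable; apply: subset_card_le => x [Ax /sK[p ps px]].
by exists p.
Qed.

Definition condensation A p :=
  forall e : R, 0 < e -> ~ countable (A `&` ball p e).

Lemma condensation_in_compact A K : compact K -> ~ countable (A `&` K) ->
  exists2 p, K p & condensation A p.
Proof.
move=> cK; apply: contra_notP => h; apply: countable_near_compact => // p Kp.
apply: contrapT => h'; apply: h; exists p => // e e0 ce.
by apply: h'; exists e.
Qed.

(** Away from a first condensation point [p], the set [A] is the union of the compact parts [K n] at
    distance at least 1/(n+1) from [p]. Were all of them countable, [A] would be countable too; an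
    uncountable one contains a second condensation point. *)
Lemma two_condensation_points A : closed A -> ~ countable A ->
  exists p q, [/\ p != q, condensation A p & condensation A q].
Proof.
move=> clA uA.
have [p Ap cp] : exists2 p, A p & condensation A p.
  by apply: condensation_in_compact; [exact: closed_is_compact|rewrite setIid].
pose K n := A `&` [set x : X | n.+1%:R^-1 <= mdist p x].
have [[n uK]|cK] := pselect (exists n, ~ countable (A `&` K n)).
  have [q [_ /= pq] cq] : exists2 q, K n q & condensation A q.
    apply: condensation_in_compact uK; apply: closed_is_compact.
    by apply: closedI => //; exact: closed_mdist_ge.
  by exists p, q; split=> //; rewrite -mdist_gt0 (lt_le_trans _ pq).
exfalso; apply: uA.
have : countable ([set p] `|` \bigcup_n (A `&` K n)).
  rewrite (_ : _ `|` _ =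
    \bigcup_(o : option nat) if o is Some n then A `&` K n else [set p]).
    apply: bigcup_countable => // -[n|] _; last exact: countable1.
    by apply: contrapT => ?; apply: cK; exists n.
  apply/seteqP; split=> [x [->|[n _ ?]]|x [[n|] _ ?]];
    [by exists None|by exists (Some n)|right|left] => //.
  by exists n.
apply: sub_countable; apply: subset_card_le => x Ax.
have [->|xp] := eqVneq x p; [by left|right].
have d0 : 0 < mdist p x by rewrite mdist_gt0 eq_sym.
exists (Num.trunc (mdist p x)^-1) => //; split=> //; split=> //=.
have d0' : 0 <= (mdist p x)^-1 by rewrite invr_ge0 ltW.
by rewrite invf_ple ?posrE// ltW//; have /andP[] := truncn_itv d0'.
Qed.

(** Closed balls around two condensation points, of radius a third of their distance, are disjoint
    and meet [A] in uncountable sets. *)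
Lemma uncountable_split A : closed A -> ~ countable A ->
  exists B : bool -> set X,
    (forall b, [/\ closed (B b), ~ countable (B b) & B b `<=` A]) /\
    B false `&` B true = set0.
Proof.
move=> clA uA; have [p [q [pq cp cq]]] := two_condensation_points clA uA.
have e0 : 0 < mdist p q / 3 by rewrite divr_gt0// mdist_gt0.
set e := mdist p q / 3 in e0.
exists (fun b => A `&` [set x | mdist (if b then p else q) x <= e]); split.
  move=> b; split; last by move=> x [].
  - by apply: closedI => //; exact: closed_mdist_le.
  - have {}cp : condensation A (if b then p else q) by case: b.
    move=> h; apply: (cp e e0); apply: sub_countable h.
    apply: subset_card_le => x [Ax]; rewrite ballEmdist /= => /ltW; by split.
rewrite -subset0 => x [[_ /= qx] [_ /= px]].
have := metric_triangle p x q; rewrite (metric_sym x q).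
have : mdist p q = e * 3 by rewrite /e divfK.
by move: px qx e0; move: (mdist p x) (mdist q x) (mdist p q) => a b c; lra.
Qed.

(* [x] parametrizes a Cantor set in [X] on which [U k] reads off the [k]-th
   digit. *)
Lemma cantor_scheme : ~ countable [set: X] ->
  exists (U : nat -> X -> R) (x : (nat -> bool) -> X),
    [/\ forall k, continuous (U k), forall k y, 0 <= U k y <= 1 &
        forall a k, U k (x a) = (a k)%:R].
Proof.
move=> uX; pose T := {A : set X | closed A /\ ~ countable A}.
have /choice[s sP] (A : T) : exists B : bool -> T,
    (forall b, sval (B b) `<=` sval A) /\
    sval (B false) `&` sval (B true) = set0.
  case: A => A [clA uA] /=; have [B [BP B0]] := uncountable_split clA uA.
  have BT b : closed (B b) /\ ~ countable (B b) by have [] := BP b.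
  exists (fun b => exist _ (B b) (BT b)); split=> // b.
  by have [] := BP b.
have TX : closed [set: X] /\ ~ countable [set: X] by split=> //; exact: closedT.
pose F (l : seq bool) := sval (foldl s (exist _ _ TX) l).
have clF l : closed (F l) by have [] := svalP (foldl s (exist _ _ TX) l).
have uF l : ~ countable (F l) by have [] := svalP (foldl s (exist _ _ TX) l).
have Frcons l b : F (rcons l b) `<=` F l.
  by rewrite /F -cats1 foldl_cat /=; have [] := sP (foldl s (exist _ _ TX) l).
have Fdisj l b b' y : F (rcons l b) y -> F (rcons l b') y -> b = b'.
  rewrite /F -!cats1 !foldl_cat /=.
  have [_ +] := sP (foldl s (exist _ _ TX) l).
  rewrite -subset0 => h; case: b; case: b' => // h1 h2; exfalso; exact: (h y).
have Finj l l' y : size l = size l' -> F l y -> F l' y -> l = l'.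
  elim/last_ind: l l' => [|l b IH] l'; first by case: l'.
  case/lastP: l' => [|l' b']; first by rewrite size_rcons.
  rewrite !size_rcons => -[ll'] Fl Fl'.
  have e := IH _ ll' (Frcons _ _ _ Fl) (Frcons _ _ _ Fl').
  by rewrite -e in Fl' *; rewrite (Fdisj _ _ _ _ Fl Fl').
(* The finitely many pieces of level k+1 whose last letter is [b]. The sets for the two letters are
   closed and disjoint, so a Urysohn function extends the [k]-th digit to all of [X]. *)
pose A k b := \bigcup_(l : k.-tuple bool) F (rcons l b).
have clA k b : closed (A k b).
  by apply: closed_bigcup => [|l _]; [exact: finite_finset|exact: clF].
have A0 k : A k false `&` A k true = set0.
  rewrite -subset0 => y [[l _ Fl] [l' _ Fl']].
  have e : (l : seq bool) = l'.
    by apply: (@Finj _ _ y); rewrite ?size_tuple//; apply: Frcons; eassumption.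
  by rewrite -e in Fl'; have := Fdisj _ _ _ _ Fl Fl'.
have sepA k : uniform_separator (A k false) (A k true).
  by apply: (proj1 (@normal_separatorP R X)) => //; exact: pseudometric_normal.
have Fnest (a : nat -> bool) j k : (j <= k)%N -> F (mkseq a k) `<=` F (mkseq a j).
  move=> /subnK <-; elim: (k - j)%N => // i IH y.
  by rewrite addSn mkseqS => /Frcons; exact: IH.
(* Every branch has a point: otherwise finitely many complements of the nested pieces would cover
   [X], leaving the deepest of these pieces empty, although it is uncountable. *)
have /choice[x xF] (a : nat -> bool) : exists y, forall k, F (mkseq a k) y.
  apply: contrapT => h.
  have /choice[k nF] y : exists k, ~ F (mkseq a k) y.
    by apply/existsNP => ?; apply: h; exists y.
  have [|l _ lX] := @compact_finite_subcover _ [set: X]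
    (fun y => ~` F (mkseq a (k y))) cX.
    by move=> y _; apply: open_nbhs_nbhs; split; [exact/closed_openC/clF|exact: nF].
  pose m := \max_(y <- l) k y; apply: (uF (mkseq a m)).
  rewrite (_ : F _ = set0); first exact: countable0.
  rewrite -subset0 => y Fy; have [z zl] := lX y I; apply.
  by apply: Fnest Fy; rewrite /m; exact: leq_bigmax_seq.
exists (fun k => Urysohn (A k false) (A k true)), x; split.
- by move=> k; exact: Urysohn_continuous.
- move=> k y; have := @Urysohn_range X R (A k false) (A k true) _ (ex_intro2 _ _ y I erefl).
  by rewrite /= in_itv.
- move=> a k; have : A k (a k) (x a).
    exists [tuple a i | i < k] => //=.
    by have := xF a k.+1; rewrite mkseqS; congr (F (rcons _ _) _);
      rewrite /mkseq -val_enum_ord -map_comp.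
  case: (a k) => h.
    by apply: (@Urysohn_sub1 X R) (sepA k) _ _; exists (x a).
  by apply: (@Urysohn_sub0 X R) (sepA k) _ _; exists (x a).
Qed.

End cantor_scheme.

(** * Independent uniform coefficients and small-ball probabilities *)

Section random_coefficients.
Variable R : realType.

Lemma integral_cst_probability d (T : measurableType d)
    (P : probability T R) (c : R) : (\int[P]_x c%:E = c%:E)%E.
Proof.
rewrite integral_cst// -[RHS]mule1; congr (_ * _)%E.
exact: probability_setT.
Qed.

(** The uniform law lives on the whole line. Clipping alters nothing on [0, 1] and makes the
    coefficients lie in [0, 1] everywhere, not just almost everywhere, so that the probe has its
    values in a compact set. *)
Definition clip (x : R) : R := Num.max 0 (Num.min x 1).

Lemma clip_itv x : 0 <= clip x <= 1.
Proof. by rewrite /clip le_max lexx/= ge_max ler01 ge_min lexx orbT. Qed.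

Lemma clip_id x : 0 <= x <= 1 -> clip x = x.
Proof. by case/andP=> x0 x1; rewrite /clip min_l// max_r. Qed.

Lemma measurable_clip : measurable_fun [set: R] clip.
Proof.
apply: measurable_maxr; first exact: measurable_cst.
by apply: measurable_minr; [exact: measurable_id|exact: measurable_cst].
Qed.

Local Notation U := (uniform_prob (@ltr01 R)).

Lemma measurable_norm_le d (T : measurableType d) (g : T -> R) (r : R) :
  measurable_fun [set: T] g -> measurable [set x | `|g x| <= r].
Proof.
move=> mg; have : measurable_fun [set: T] (fun x => `|g x|).
  exact: measurableT_comp.
move=> /(_ measurableT `]-oo, r]%classic); rewrite setTI.
by move=> /(_ (measurable_itv _)); congr measurable; apply/seteqP; split=> x /=;
  rewrite in_itv.
Qed.

(** Inside [0, 1] the event lies in an interval of length 2r / |v|, where the density is 1. The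
    bound does not depend on [a], which is what later makes it uniform over translates. *)
Lemma uniform_affine_le (a v r : R) : v != 0 -> 0 <= r ->
  (U [set x | (`|a + clip x * v| <= r)%R] <= (2 * r / `|v|)%:E)%E.
Proof.
move=> v0 r0; set A := [set x | _].
have mA : measurable A.
  apply: (@measurable_norm_le _ R (fun x => a + clip x * v)).
  by apply: measurable_funD => //; apply: measurable_funM => //; exact: measurable_clip.
have mA01 : measurable (A `&` `[0, 1]%classic) by apply: measurableI.
have v0' : 0 < `|v| by rewrite normr_gt0.
rewrite /uniform_prob integral_uniform_pdf.
rewrite (eq_integral (fun=> 1%E)); last first.
  by move=> x; rewrite inE /= in_itv /= => -[_ x01]; rewrite /uniform_pdf x01 subr0 invr1.
rewrite integral_cst// mul1e.
pose l := - a / v - r / `|v|; pose u := - a / v + r / `|v|.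
apply: (@le_trans _ _ (lebesgue_measure `[l, u]%classic)).
  apply: le_measure; rewrite ?inE//.
  rewrite /A => x [/= + x01]; rewrite in_itv/= in x01; rewrite clip_id// in_itv/= => h.
  have : `|x + a / v| <= r / `|v|.
    rewrite ler_pdivlMr// -normrM mulrDl divfK// addrC (le_trans _ h)//.
  by rewrite ler_norml /l /u => /andP[? ?]; apply/andP; split; lra.
rewrite lebesgue_measure_itv /=; case: ifP => _; last first.
  by rewrite lee_fin divr_ge0// mulr_ge0.
rewrite -EFinB lee_fin /l /u; lra.
Qed.

Lemma product_affine_le d (T : measurableType d) (P : probability T R)
    (g : T -> R) (v r : R) : measurable_fun [set: T] g -> v != 0 -> 0 <= r ->
  ((P \x U) [set p | (`|g p.1 + clip p.2 * v| <= r)%R] <= (2 * r / `|v|)%:E)%E.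
Proof.
move=> mg v0 r0; rewrite /product_measure1.
apply: (@le_trans _ _ (\int[P]_x (2 * r / `|v|)%:E)%E); last first.
  by rewrite integral_cst_probability.
apply: ge0_le_integral => //=.
  apply: measurable_fun_xsection; apply: measurable_norm_le.
  apply: measurable_funD; first exact: measurableT_comp.
  by apply: measurable_funM => //; apply: measurableT_comp => //; exact: measurable_clip.
move=> x _; apply: le_trans (uniform_affine_le (g x) v0 r0).
rewrite le_eqVlt; apply/orP; left; apply/eqP; congr (uniform_prob _ _).
by apply/seteqP; split=> y; rewrite /xsection /= inE.
Qed.

Lemma product_affine2_le (c v0 v1 r q : R) : 0 <= r ->
  1 <= q \/ (v0 != 0 /\ 2 * r / `|v0| <= q) \/ (v1 != 0 /\ 2 * r / `|v1| <= q) ->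
  ((U \x U) [set p : R * R | (`|c + clip p.1 * v0 + clip p.2 * v1| <= r)%R]
    <= q%:E)%E.
Proof.
move=> r0; set A := [set p : R * R | _].
have mg : measurable_fun [set: R * R] (fun p => c + clip p.1 * v0 + clip p.2 * v1).
  apply: measurable_funD; first apply: measurable_funD => //.
    by apply: measurable_funM => //; apply: measurableT_comp => //; exact: measurable_clip.
  by apply: measurable_funM => //; apply: measurableT_comp => //; exact: measurable_clip.
have mA : measurable A by exact: measurable_norm_le.
case=> [q1|[[v00 vq]|[v10 vq]]].
- by apply: (@le_trans _ _ 1%E); [exact: probability_le1|rewrite lee_fin].
(* To integrate over the first coefficient with the second one fixed, the product measure is
   rewritten with the order of integration exchanged. *)
- rewrite (product_measure_unique (m' := U \x^ U)%E) //; last first.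
    by move=> B C mB mC; exact: product_measure2E.
  rewrite /product_measure2.
  apply: (@le_trans _ _ (\int[U]_x q%:E)%E); last first.
    by rewrite integral_cst_probability.
  apply: ge0_le_integral => //=.
    exact: measurable_fun_ysection.
  move=> y _; apply: (@le_trans _ _ (2 * r / `|v0|)%:E); last by rewrite lee_fin.
  apply: le_trans (uniform_affine_le (c + clip y * v1) v00 r0).
  rewrite le_eqVlt; apply/orP; left; apply/eqP; congr (uniform_prob _ _).
  by apply/seteqP; split=> x; rewrite /ysection /= inE /A /= addrAC.
- apply: (@le_trans _ _ (2 * r / `|v1|)%:E); last by rewrite lee_fin.
  have := @product_affine_le _ _ U (fun x => c + clip x * v0) v1 r _ v10 r0.
  apply.
  apply: measurable_funD => //; apply: measurable_funM => //.
  exact: measurable_clip.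
Qed.

(** Induction on [n], adjoining two fresh uniform variables for coordinate [ord0]: the event becomes
    a rectangle, so the probabilities multiply. In each coordinate [q i] is either trivial (at least
    1) or bounds the small-ball probability from one of the two coefficients. *)
Lemma random_coefficients (n : nat) :
  exists (d : measure_display) (T : measurableType d) (P : probability T R)
    (t : 'I_n -> bool -> T -> R),
  [/\ forall i b, measurable_fun [set: T] (t i b),
      forall i b x, 0 <= t i b x <= 1 &
      forall (c : 'I_n -> R) (v : 'I_n -> bool -> R) (r : R) (q : 'I_n -> R),
        0 <= r -> (forall i, 0 <= q i) ->
        (forall i, 1 <= q i \/
          exists2 b, v i b != 0 & 2 * r / `|v i b| <= q i) ->
        (P [set x | forall i, (`|c i + t i false x * v i false
                                  + t i true x * v i true| <= r)%R]
          <= (\prod_i q i)%:E)%E].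
Proof.
elim: n => [|n [d [T [P [t [mt t01 tP]]]]]].
  exists _, (measurableTypeR R), U, (fun _ _ => cst 0); split=> [[]//|[]//|c v r q r0 _ _].
  apply: (@le_trans _ _ 1%E); last by rewrite lee_fin big_ord0.
  by apply: probability_le1; rewrite (_ : [set x | _] = setT)//;
    apply/seteqP; split=> // x _ [].
pose R' := measurableTypeR R.
pose s (i : 'I_n.+1) (b : bool) (p : T * (R' * R')) : R :=
  if unlift ord0 i is Some j then t j b p.1
  else clip (if b then p.2.2 else p.2.1).
have ms i b : measurable_fun [set: T * (R' * R')] (s i b).
  rewrite /s; case: unliftP => [j _|_]; first exact: measurableT_comp.
  apply: measurableT_comp; first exact: measurable_clip.
  by case: b; apply: measurableT_comp.
exists _, (T * (R' * R'))%type.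
exists (P \x (U \x U))%E, s; split=> //.
  by move=> i b x; rewrite /s; case: unliftP => [j _|_]; rewrite ?t01 ?clip_itv.
move=> c v r q r0 q0 vq.
pose A := [set x | forall i : 'I_n, `|c (lift ord0 i)
  + t i false x * v (lift ord0 i) false + t i true x * v (lift ord0 i) true| <= r].
pose B := [set p : R' * R' | `|c ord0 + clip p.1 * v ord0 false
  + clip p.2 * v ord0 true| <= r].
have mA : measurable A.
  rewrite (_ : A = \bigcap_(i in [set: 'I_n]) [set x | `|c (lift ord0 i)
    + t i false x * v (lift ord0 i) false + t i true x * v (lift ord0 i) true| <= r]).
    apply: fin_bigcap_measurable => // i _; apply: measurable_norm_le.
    by apply: measurable_funD; [apply: measurable_funD|] => //; apply: measurable_funM.
  by apply/seteqP; split=> x /= h => [i _|i]; [exact: h|exact: (h i I)].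
have mB : measurable B.
  apply: measurable_norm_le.
  by apply: measurable_funD; [apply: measurable_funD => //|];
    apply: measurable_funM => //; apply: measurableT_comp => //; exact: measurable_clip.
rewrite (_ : [set x | _] = A `*` B); last first.
  apply/seteqP; split=> [[x p] h|[x p] [hA hB] i].
    split=> [i|] /=.
      by have := h (lift ord0 i); rewrite /s liftK.
    by have := h ord0; rewrite /s unlift_none.
  rewrite /s; case: unliftP => [j ->|->]; first exact: hA.
  exact: hB.
apply: (@le_trans _ _ (P A * (U \x U) B)%E).
  by rewrite le_eqVlt; apply/orP; left; apply/eqP; exact: product_measure1E.
rewrite big_ord_recl EFinM muleC lee_pmul//.
  apply: product_affine2_le => //; have [q1|[b vb h]] := vq ord0; [by left|right].
  by case: b vb h => vb h; [right|left].
exact: (tP (fun i => c (lift ord0 i)) (fun i => v (lift ord0 i)) r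
  (fun i => q (lift ord0 i))).
Qed.

End random_coefficients.

(** * Ternary digit functions *)

Section digit_series.
Variables (R : realType) (X : topologicalType) (u : nat -> X -> R).
Hypothesis cu : forall k, continuous (u k).
Hypothesis u01 : forall k x, 0 <= u k x <= 1.

Let s N x : R := \sum_(k < N) 3 ^- k.+1 * u k x.

Let p3 N : 0 < 3 ^- N :> R. Proof. by rewrite invr_gt0 exprn_gt0. Qed.

Let s_tail N M x : 0 <= s (N + M) x - s N x <= (3 ^- N - 3 ^- (N + M)) / 2.
Proof.
elim: M => [|M /andP[h1 h2]]; first by rewrite addn0 !subrr mul0r lexx.
have -> : s (N + M.+1) x = s (N + M) x + 3 ^- (N + M).+1 * u (N + M) x.
  by rewrite addnS /s big_ord_recr.
rewrite addnS.
have /andP[u0 u1] := u01 (N + M) x.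
have : 3 ^- (N + M) = 3 * 3 ^- (N + M).+1 :> R.
  by rewrite exprS invfM mulrA divff ?mul1r.
have : 0 < 3 ^- (N + M).+1 :> R by rewrite invr_gt0 exprn_gt0.
move: h1 h2; set a := s _ _ => h1 h2; set t := 3 ^- (N + M).+1 => t0 e.
by rewrite e in h2; apply/andP; split; nra.
Qed.

Let s_ub x : has_ubound (range (s ^~ x)).
Proof.
have s0 : s 0 x = 0 by rewrite /s big_ord0.
exists (2^-1) => _ [N _ <-] /=; have /andP[_] := s_tail 0 N x.
rewrite add0n s0 subr0 expr0 invr1.
by have := p3 N; lra.
Qed.

(** At the first disagreement [l] the series jumps by 3^-(l+1). Both tails beyond it lie between 0
    and half of that, so they cancel at most half of the jump. *)
Lemma digit_series : exists2 phi : X -> R, continuous phi &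
  forall x y l, (forall k, (k < l)%N -> u k x = u k y) ->
    `|u l x - u l y| = 1 -> 3 ^- l.+1 / 2 <= `|phi x - phi y|.
Proof.
(* The partial sums increase, so the supremum is the sum of the series; [s_phi] makes the
   convergence uniform. *)
pose phi x := sup (range (s ^~ x)).
have s_phi N x : 0 <= phi x - s N x <= 3 ^- N / 2.
  apply/andP; split.
    by rewrite subr_ge0; apply: ub_le_sup; [exact: s_ub|exists N].
  rewrite lerBlDr; apply: ge_sup; first by exists (s 0%N x); exists 0%N.
  move=> _ [M _ <-]; have [NM|/ltnW MN] := leqP N M.
    have := s_tail N (M - N) x; rewrite subnKC// => /andP[_].
    by have := p3 M; lra.
  have := s_tail M (N - M) x; rewrite subnKC// => /andP[h _].
  by have := p3 N; lra.
have cs N : continuous (s N).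
  move=> x; rewrite /s; elim: N => [|N IH].
    by under eq_fun do rewrite big_ord0; exact: cst_continuous.
  under eq_fun do rewrite big_ord_recr /=.
  by apply: cvgD => //; apply: cvgMr; exact: cu.
exists phi.
  move=> x; apply/cvgrPdist_lt => e e0.
  have [N Ne] : exists N, 3 ^- N < e :> R.
    exists (Num.trunc e^-1); rewrite invf_plt ?posrE ?exprn_gt0//.
    have /andP[_] := truncn_itv (ltW (etrans (invr_gt0 e) e0)).
    by move/lt_le_trans; apply; rewrite -natrX ler_nat ltn_expl.
  have /cvgrPdist_lt/(_ (e / 2)) := cs N x; rewrite divr_gt0// => /(_ isT).
  apply: filterS => y; have := s_phi N x; have := s_phi N y.
  move=> /andP[? ?] /andP[? ?]; rewrite !ltr_norml => /andP[? ?].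
  by apply/andP; split; lra.
move=> x y l kl ul.
have := s_phi l.+1 x; have := s_phi l.+1 y.
have -> : s l.+1 x = s l x + 3 ^- l.+1 * u l x by rewrite /s big_ord_recr.
have -> : s l.+1 y = s l x + 3 ^- l.+1 * u l y.
  rewrite /s big_ord_recr /=; congr (_ + _).
  by apply: eq_bigr => k _; rewrite kl.
set t := 3 ^- l.+1; have t0 : 0 < t by rewrite invr_gt0 exprn_gt0.
have : `|t * u l x - t * u l y| = t by rewrite -mulrBr normrM ul mulr1 gtr0_norm.
move: (t * u l x) (t * u l y) (s l x) (phi x) (phi y) => a b c p q.
have := ler_norm (p - q); have := ler_norm (q - p); rewrite (distrC q p).
have [ab|ab] := lerP 0 (a - b).
  by rewrite (ger0_norm ab) => ? ? ? /andP[? ?] /andP[? ?]; lra.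
by rewrite (ltr0_norm ab) => ? ? ? /andP[? ?] /andP[? ?]; lra.
Qed.

End digit_series.

(** * Counting words and collisions *)

Section words.
Variables (R : realType) (T : finType).

(* Equals [1] if [u = v], and [12 r 3 ^ l] if [u] and [v] first differ at
   position [l]. *)
Fixpoint word_weight (r : R) (u v : seq T) : R :=
  match u, v with
  | a :: u', b :: v' => if a == b then word_weight (3 * r) u' v' else 12 * r
  | _, _ => 1
  end.

Lemma word_weight_ge0 r u v : 0 <= r -> 0 <= word_weight r u v.
Proof.
elim: u v r => [|a u IH] [|b v] r r0 //=; case: ifP => _.
  by apply: IH; rewrite mulr_ge0.
by rewrite mulr_ge0.
Qed.

Lemma word_weightP x0 r u v : size u = size v ->
  word_weight r u v = 1 \/
  exists l, [/\ (l < size u)%N, forall k, (k < l)%N -> nth x0 u k = nth x0 v k,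
    nth x0 u l <> nth x0 v l & word_weight r u v = 12 * r * 3 ^+ l].
Proof.
elim: u v r => [|a u IH] [|b v] r //=; [by left|move=> [uv]].
case: eqVneq => [<-|ab]; last first.
  by right; exists 0%N; split=> //=; [exact/eqP|rewrite mulr1].
have [->|[l [lu kl nl ->]]] := IH v (3 * r) uv; [by left|right].
exists l.+1; split=> //=; first by case=> [//|k] /kl.
by rewrite exprS; ring.
Qed.

(** Words with the same first letter contribute the sum for 3r and m-1; the three other letters
    contribute 3 * 12 r 4^(m-1). The constant 36 closes the induction, because 36 * 3 + 36 = 36 *
    4. *)
Lemma sum_word_weight (r : R) (m : nat) (u : m.-tuple T) : 0 <= r -> #|T| = 4 ->
  \sum_(v : m.-tuple T) word_weight r u v <= 1 + 36 * r * 4 ^+ m.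
Proof.
move=> + T4; elim: m r u => [|m IH] r u r0.
  rewrite (eq_bigr (fun=> 1)); last by move=> v _; rewrite (tuple0 v); case: (tval u).
  by rewrite sumr_const card_tuple expn0 lerDl mulr1 mulr_ge0.
rewrite (reindex (fun p : T * m.-tuple T => [tuple of p.1 :: p.2])) /=; last first.
  exists (fun w => (thead w, [tuple of behead w])) => [[a w] _|w _].
    by congr pair; apply: val_inj.
  by rewrite -tuple_eta.
rewrite -(pair_bigA _ (fun a (w : m.-tuple T) => word_weight r u (a :: w))) /=.
case/tupleP: u => a u; rewrite (bigD1 a)//=.
rewrite (eq_bigr (fun w : m.-tuple T => word_weight (3 * r) u w)); last first.
  by move=> w _; rewrite eqxx.
rewrite [X in _ + X](eq_bigr (fun=> 12 * r * 4 ^+ m)); last first.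
  move=> b ba; transitivity (\sum_(w : m.-tuple T) 12 * r); last first.
    by rewrite sumr_const card_tuple T4 -[LHS]mulr_natr natrX.
  by apply: eq_bigr => w _; rewrite eq_sym (negbTE ba).
rewrite sumr_const (_ : #|_| = 3%N); last first.
  by rewrite cardC1 T4.
have := IH (3 * r) u; rewrite mulr_ge0// => /(_ isT) h.
rewrite exprS; set q := 4 ^+ m in h *.
have -> : 12 * r * q *+ 3 = 36 * r * q by ring.
by apply: le_trans (lerD h (lexx _)) _; lra.
Qed.

End words.

(** Cauchy-Schwarz for the fibre sizes [a c], whose squares add up to the number of collisions. It
    is obtained by summing 2 (a c) (a d) <= (a c)^2 + (a d)^2 over all pairs of keys. *)
Lemma sqr_card_le_collisions (W C : finType) (key : W -> C) :
  (#|W| ^ 2 <= #|C| * #|[pred p : W * W | key p.1 == key p.2]|)%N.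
Proof.
pose a c := #|[pred w | key w == c]|.
have aE c : (\sum_(w | key w == c) 1 = a c)%N by rewrite sum1_card.
have WE : #|W| = (\sum_c a c)%N.
  rewrite -sum1_card (partition_big key xpredT)//=.
  by apply: eq_bigr => c _; rewrite -aE.
have -> : #|[pred p : W * W | key p.1 == key p.2]| = (\sum_c a c ^ 2)%N.
  rewrite -sum1_card -(pair_big_dep xpredT (fun w w' => key w == key w')
    (fun _ _ => 1%N)) /=.
  rewrite (partition_big key xpredT)//=; apply: eq_bigr => c _.
  rewrite (eq_bigr (fun=> a c)); last first.
    move=> w /eqP wc; rewrite -aE; apply: eq_bigl => w'.
    by rewrite wc eq_sym.
  under eq_bigr do rewrite -[a c]mul1n.
  by rewrite -big_distrl /= aE mulnn.
rewrite WE -(leq_pmul2l (ltn0Sn 1)).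
apply: (@leq_trans (\sum_c \sum_d (a c ^ 2 + a d ^ 2))%N).
  rewrite -mulnn big_distrl /= big_distrr /=; apply: leq_sum => c _.
  rewrite big_distrr /= big_distrr /=; apply: leq_sum => d _.
  exact: nat_Cauchy.
rewrite (eq_bigr (fun c => #|C| * a c ^ 2 + \sum_d a d ^ 2)%N); last first.
  by move=> c _; rewrite big_split /= sum_nat_const.
by rewrite big_split /= sum_nat_const -big_distrr /= addnn mul2n.
Qed.

(** * Few close pairs force a large Hausdorff dimension *)

Section lower_bound.
Variables (R : realType) (X : metricType R).
Hypothesis cX : compact [set: X].
Variables (n : nat) (f : X -> eucl R n).
Hypothesis n_gt0 : (0 < n)%N.
Hypothesis cf : continuous f.

(** Ordered pairs, diagonal included, compared coordinatewise to match grid cells. The inequality is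
    not strict, so that having few close pairs is an open condition on [f]. *)
Definition close_pairs (W : finType) (x : W -> X) (r : R) : pred (W * W) :=
  [pred p : W * W | [forall i, `|(f (x p.1) : 'rV[R]_n) 0 i
                               - (f (x p.2) : 'rV[R]_n) 0 i| <= r]].

Lemma sum_geometric_half (e : R) (P : nat) :
  \sum_(i < P) e / 2 ^+ i.+1 = e - e / 2 ^+ P.
Proof.
elim: P => [|P IH]; first by rewrite big_ord0 expr0 divr1 subrr.
by rewrite big_ord_recr /= IH exprS invfM; field.
Qed.

Lemma exprD_le (a b : R) : 0 <= a -> 0 <= b ->
  (a + b) ^+ n <= 2 ^+ n * (a ^+ n + b ^+ n).
Proof.
move=> a0 b0; have [ab|ba] := leP a b.
  apply: (@le_trans _ _ ((2 * b) ^+ n)).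
    by rewrite lerXn2r ?nnegrE ?addr_ge0 ?mulr_ge0//; lra.
  by rewrite exprMn ler_wpM2l ?exprn_ge0// lerDr exprn_ge0.
apply: (@le_trans _ _ ((2 * a) ^+ n)).
  by rewrite lerXn2r ?nnegrE ?addr_ge0 ?mulr_ge0//; lra.
by rewrite exprMn ler_wpM2l ?exprn_ge0// lerDl exprn_ge0.
Qed.

(** Only the values in R^n are kept from a cover of the graph. Enlarging the diameters [a i] by e /
    2^(i+1) gives open balls of positive radius, to which compactness of [X] applies. As [a i] is at
    most 1 and s < n, the sum of the (a i)^n is below that of the (a i)^s, which is at most [e]; the
    enlargements add at most [e] more. *)
Lemma finite_ball_cover (s e : R) : 0 < s -> s < n%:R -> 0 < e <= 1 ->
  hausdorff_measure s (graph f) = 0%E ->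
  exists (P : nat) (y : 'I_P -> eucl R n) (d : 'I_P -> R),
    [/\ forall i, 0 < d i, forall x, exists i, `|f x - y i| < d i &
        \sum_i d i ^+ n <= 2 ^+ n * (2 * e)].
Proof.
move=> s0 sn /andP[e0 e1] /hausdorff_measure_eq0P/(_ 1 ltr01) G0.
have : (hausdorff_premeasure s 1 (graph f) < e%:E)%E by rewrite G0 lte_fin.
move=> /premeasure_lt[U [GU dU Us]].
have fd i : (diam (U i))%E = (fine (diam (U i)))%:E.
  rewrite fineK// ge0_fin_numE ?diam_ge0// (le_lt_trans (dU i)) ?ltry//.
pose a i := fine (diam (U i)).
have a0 i : 0 <= a i by rewrite fine_ge0// diam_ge0.
have a1 i : a i <= 1 by rewrite -lee_fin -fd.
pose d i := a i + e / 2 ^+ i.+1.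
have h0 i : 0 < e / 2 ^+ i.+1 by rewrite divr_gt0// exprn_gt0.
have d0 i : 0 < d i by rewrite ltr_wpDl.
have /choice[y yP] i : exists y : eucl R n, forall p, U i p -> `|p.2 - y| < d i.
  have [[q Uq]|nU] := pselect (exists q, U i q); last first.
    by exists 0 => p Up; exfalso; apply: nU; exists p.
  exists q.2 => p Up; apply: (@le_lt_trans _ _ (a i)); last by rewrite ltrDl.
  rewrite -lee_fin /a -fd; apply: le_trans (le_diam Up Uq).
  by rewrite lee_fin le_max lexx orbT.
have /choice[k kP] x : exists i, U i (x, f x).
  by have [i _ Ui] := GU (x, f x) (ex_intro2 _ _ x I erefl); exists i.
have [|l _ lX] := @compact_finite_subcover _ _
    (fun p => [set x | `|f x - y (k p)| < d (k p)]) cX.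
  move=> p _; have := yP _ _ (kP p) => /= fp.
  have /cvgrPdist_lt/(_ (d (k p) - `|f p - y (k p)|)) := @cf p.
  rewrite subr_gt0 => /(_ fp); apply: filterS => x /= px.
  rewrite -(subrKA (f p)) (le_lt_trans (ler_normD _ _))// -ltrBrDr.
  by rewrite distrC.
pose P := (\max_(p <- l) k p).+1.
exists P, (fun i => y i), (fun i => d i); split=> //.
  move=> x; have [p pl px] := lX x I.
  have kp : (k p < P)%N by rewrite ltnS; exact: leq_bigmax_seq.
  by exists (Ordinal kp).
apply: (@le_trans _ _ (\sum_(i < P) 2 ^+ n * (a i `^ s + e / 2 ^+ i.+1))).
  apply: ler_sum => i _; apply: le_trans (exprD_le (a0 i) (ltW (h0 i))) _.
  rewrite ler_wpM2l ?exprn_ge0// lerD//.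
    have [->|ai0] := eqVneq (a i) 0.
      by rewrite expr0n gtn_eqF// powR_ge0.
    rewrite -powR_mulrn//; apply: ger_powR (ltW sn).
    by rewrite lt_neqAle eq_sym ai0 a0 a1.
  rewrite -[leRHS]expr1 ler_wiXn2l ?(ltW (h0 i))//.
  rewrite ler_pdivrMr ?exprn_gt0// mul1r (le_trans e1)//.
  by rewrite exprn_ege1// ler1n.
rewrite -mulr_sumr ler_wpM2l ?exprn_ge0// big_split /= sum_geometric_half.
have : \sum_(i < P) a i `^ s <= e.
  rewrite -lee_fin -sumEFin; apply: le_trans (ltW Us).
  rewrite -(big_mkord xpredT (fun i => (a i `^ s)%:E)).
  apply: le_trans (nneseries_lim_ge P _); last first.
    by move=> i _ _; exact: poweR_ge0.
  by apply: lee_sum => i _; rewrite fd poweR_EFin.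
have : 0 < e / 2 ^+ P by rewrite divr_gt0// exprn_gt0.
lra.
Qed.

(* Cells of side [r] cut out of the cover above are too few to hold [W]
   without many collisions, that is, close pairs. *)
Lemma hausdorff_dim_graph_ge (K : R) :
  (forall rho : R, 0 < rho -> exists (W : finType) (x : W -> X) (r : R),
    [/\ 0 < r <= rho, 1 <= r ^+ n * #|W|%:R &
        #|close_pairs x r|%:R <= K * #|W|%:R]) ->
  (n%:R%:E <= hausdorff_dim (graph f))%E.
Proof.
move=> good; rewrite leNgt; apply/negP => /hausdorff_dim_lt[s [s0 sn G0]].
rewrite lte_fin in sn.
pose K' := Num.max 1 K; have K1 : 1 <= K' by rewrite le_max lexx.
(* There will be at most 6^n (2e) / r^n cells, where 6 is 2 from the ball cover times 3 from the
   cells per ball. With at most K' |W| collisions, this [e] makes cells times collisions at most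
   |W|^2 / 2, against Cauchy-Schwarz. *)
pose e : R := (6 ^+ n * 4 * K')^-1.
have D1 : 1 <= 6 ^+ n * 4 * K'.
  have : 1 <= 6 ^+ n :> R by rewrite exprn_ege1// ler1n.
  set q := _ ^+ _ => q1; nra.
have D0 : 0 < 6 ^+ n * 4 * K' by rewrite (lt_le_trans _ D1).
have e01 : 0 < e <= 1 by rewrite invr_gt0 D0/= invf_le1.
have [P [y [d [d0 yd dsum]]]] := finite_ball_cover s0 sn e01 G0.
have [rho rho0 rhod] : exists2 rho, 0 < rho & forall i, rho <= d i.
  exists (\big[Num.min/1]_i d i); first exact: lt_bigmin.
  have /bigmin_geP[_ h] := lexx (\big[Num.min/1]_i d i).
  by move=> i; exact: h.
have [W [x [r [/andP[r0 rrho] rW WK]]]] := good rho rho0.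
have rd i : r <= d i by exact: le_trans (rhod i).
pose h i := (Num.trunc (2 * d i / r)).+1.
have d20 i : 0 <= 2 * d i by rewrite mulr_ge0// ltW.
pose grid i := cid (@grid_partition R n
  (fun j => (y i : 'rV[R]_n) 0 j - d i) (2 * d i) r (d20 i) r0).
pose cell i := projT1 (grid i); have cellP i := projT2 (grid i).
have /choice[b bP] : forall w, exists i, `|f (x w) - y i| < d i.
  by move=> w; exact: yd.
pose g w j := (f (x w) : 'rV[R]_n) 0 j.
(* A key is a ball together with one of its cells; the number of cells depends on the ball, hence
   the dependent pair. *)
pose key w : {i : 'I_P & {ffun 'I_n -> 'I_(h i)}} := Tagged _ (cell (b w) (g w)).
have gP w j : (y (b w) : 'rV[R]_n) 0 j - d (b w) <= g w j <=
    (y (b w) : 'rV[R]_n) 0 j - d (b w) + 2 * d (b w).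
  have := le_lt_trans (coord_le_enorm (f (x w) - y (b w)) j) (bP w).
  by rewrite !mxE ltr_norml -/(g w j) => /andP[? ?]; apply/andP; split; lra.
have key_close : [pred p | key p.1 == key p.2] \subset close_pairs x r.
  apply/fintype.subsetP => -[w w']; rewrite !inE /= => /eqP kww'.
  apply/forallP => j; rewrite -/(g w j) -/(g w' j).
  have bb : b w = b w' by move: kww' => /(congr1 (fun z => tag z)).
  have := gP w'; move: kww'; rewrite /key -bb => kww' gw'.
  by apply: cellP (gP w) gw' _ j; exact: eq_from_Tagged kww'.
have cardC : #|{: {i : 'I_P & {ffun 'I_n -> 'I_(h i)}}}|%:R
    <= 6 ^+ n * (2 * e) / r ^+ n :> R.
  rewrite card_tagged sumnE big_map big_enum /= natr_sum.
  apply: (@le_trans _ _ (\sum_i 3 ^+ n * d i ^+ n / r ^+ n)).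
    apply: ler_sum => i _; rewrite card_ffun !card_ord natrX.
    have /andP[t _] := truncn_itv (divr_ge0 (d20 i) (ltW r0)).
    (* The extra cell from rounding is absorbed because [r] is at most [d i]. *)
    have hi : (h i)%:R <= 3 * d i / r.
      rewrite /h -natr1 ler_pdivlMr// mulrDl mul1r.
      by move: t; rewrite ler_pdivlMr// => t; have := rd i; lra.
    by rewrite -exprMn -expr_div_n lerXn2r ?nnegrE// (le_trans _ hi).
  rewrite -mulr_suml -mulr_sumr ler_wpM2r ?invr_ge0 ?exprn_ge0 ?(ltW r0)//.
  rewrite (_ : 6 = 3 * 2 :> R); last by ring.
  by rewrite exprMn -mulrA ler_wpM2l ?exprn_ge0.
have W0 : 0 < #|W|%:R :> R.
  rewrite -(pmulr_rgt0 _ (exprn_gt0 n r0)); exact: lt_le_trans rW.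
have := sqr_card_le_collisions key; rewrite -(ler_nat R) natrX natrM.
apply/negP; rewrite -ltNge.
apply: (@le_lt_trans _ _ ((6 ^+ n * (2 * e) / r ^+ n) * (K' * #|W|%:R))).
  apply: ler_pM => //; apply: (@le_trans _ _ #|close_pairs x r|%:R).
    by rewrite ler_nat subset_leq_card.
  by rewrite (le_trans WK)// ler_wpM2r// le_max lexx orbT.
have -> : 6 ^+ n * (2 * e) / r ^+ n * (K' * #|W|%:R) = (r ^+ n)^-1 * #|W|%:R / 2.
  rewrite /e; field.
  by rewrite !expf_neq0 ?gt_eqF//= (lt_le_trans _ K1).
have : (r ^+ n)^-1 <= #|W|%:R.
  by rewrite -[leLHS]mul1r ler_pdivrMr ?exprn_gt0// mulrC.
rewrite expr2; move: W0; set N := #|W|%:R; set q := _^-1; nra.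
Qed.

End lower_bound.

(** * Tools from measure theory *)

Section measure_lemmas.
Variables (R : realType).

Lemma finite_markov d (T : measurableType d) (P : probability T R)
    (I : finType) (A : I -> set T) (k : nat) (B : set T) :
  (forall i, measurable (A i)) -> measurable B ->
  (forall x, B x -> (k <= #|[pred i | `[< A i x >]]|)%N) ->
  (k%:R%:E * P B <= \sum_i P (A i))%E.
Proof.
move=> mA mB Bk.
have -> : (\sum_i P (A i) = \int[P]_x \sum_i (\1_(A i) x)%:E)%E.
  rewrite ge0_integral_sum//=.
  - by apply: eq_bigr => i _; rewrite integral_indic// setIT.
  - by move=> i; apply/measurable_EFinP.
have -> : (k%:R%:E * P B = \int[P]_x (k%:R%:E * (\1_B x)%:E))%E.
  by rewrite ge0_integralZl ?integral_indic ?setIT//; apply/measurable_EFinP.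
apply: ge0_le_integral => //.
- by apply: emeasurable_funM => //; apply/measurable_EFinP.
- by apply: emeasurable_sum => i; apply/measurable_EFinP.
move=> x _; rewrite sumEFin -EFinM lee_fin indicE.
have [xB|xB] := boolP (x \in B); last first.
  by rewrite mulr0 sumr_ge0// => i _; rewrite indicE.
rewrite mulr1; apply: (@le_trans _ _ #|[pred i | `[< A i x >]]|%:R).
  by rewrite ler_nat Bk// -in_setE.
rewrite -sum1_card natr_sum big_mkcond /=; apply: ler_sum => i _.
by rewrite indicE inE; case: asboolP => [/mem_set ->|].
Qed.

(** For fixed [k] the intersections increase with [M], so their union has measure at most c / (k+1)
    by continuity from below; then [k] tends to infinity. No summability over [m] enters. *)
Lemma null_bigcap_liminf d (T : measurableType d) (P : probability T R)
    (B : nat -> nat -> set T) (c : R) : (forall k m, measurable (B k m)) ->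
  (forall k m, (k.+1%:R%:E * P (B k m) <= c%:E)%E) ->
  P (\bigcap_k \bigcup_M \bigcap_(m in [set m | (M <= m)%N]) B k m) = 0%E.
Proof.
move=> mB Bc; set Z := \bigcap_k _.
have mC k M : measurable (\bigcap_(m in [set m | (M <= m)%N]) B k m).
  by apply: bigcap_measurable => //; exists M => /=.
have mC' k : measurable (\bigcup_M \bigcap_(m in [set m | (M <= m)%N]) B k m).
  exact: bigcupT_measurable.
have mZ : measurable Z by exact: bigcapT_measurable.
have Zk k : (k.+1%:R%:E * P Z <= c%:E)%E.
  apply: (@le_trans _ _ (k.+1%:R%:E *
    P (\bigcup_M \bigcap_(m in [set m | (M <= m)%N]) B k m))%E).
    apply: lee_wpmul2l; first by rewrite lee_fin.
    by apply: le_measure; rewrite ?inE// => x; apply.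
  rewrite -lee_pdivlMl//.
  have := nondecreasing_cvg_mu (mu := P) (mC k) (mC' k).
  have nd : nondecreasing_seq (fun M => \bigcap_(m in [set m | (M <= m)%N]) B k m).
    by move=> a b ab; apply/subsetPset => x h m /= bm; apply: h => /=; exact: leq_trans bm.
  move=> /(_ nd) /cvg_lim <- //.
  apply: lime_le; first by apply/cvg_ex; eexists; exact: nondecreasing_cvg_mu.
  near=> M; rewrite /= lee_pdivlMl//; apply: le_trans (Bc k M).
  apply: lee_wpmul2l; first by rewrite lee_fin.
  by apply: le_measure; rewrite ?inE// => x; apply => /=.
apply/eqP; rewrite eq_le measure_ge0 andbT leNgt; apply/negP => Z0.
have Zf : P Z \is a fin_num by rewrite fin_num_measure.
move: Zk Z0; rewrite -(fineK Zf); set z := fine _ => Zk; rewrite lte_fin => z0.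
have := Zk (Num.trunc `|c / z|); rewrite -EFinM lee_fin leNgt => /negP; apply.
rewrite -ltr_pdivrMr//; apply: le_lt_trans (ler_norm _) _.
by have /andP[] := truncn_itv (normr_ge0 (c / z)).
Unshelve. all: by end_near. Qed.

Lemma pushforward_probability d d' (T : measurableType d)
    (T' : measurableType d') (P : probability T R) (f : T -> T') :
  measurable_fun [set: T] f ->
  exists Q : probability T' R, forall A, Q A = P (f @^-1` A).
Proof.
move=> mf; pose mixin := isMeasurableFun.Build _ _ _ _ f mf.
pose F : {mfun T >-> T'} := HB.pack f mixin.
by exists (distribution P F).
Qed.

(** An open set is the countable union of the closed cubes inside it with rational centre and
    half-side 1/(k+1), and a cube pulls back to finitely many conditions on single coordinates. *)
Lemma measurable_open_preimage d (T : measurableType d) (N : nat)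
    (t : 'I_N -> T -> R) (O : set 'rV[R]_N) :
  (forall j, measurable_fun [set: T] (t j)) -> open O ->
  measurable [set w : T | O (\row_j t j w)].
Proof.
move=> mt oO.
pose Q := [set p : 'rV[rat]_N * nat | forall v : 'rV[R]_N,
  (forall j, `|v 0 j - ratr (p.1 0 j)| <= p.2.+1%:R^-1) -> O v].
rewrite (_ : [set w | _] = \bigcup_(p in Q)
  \bigcap_(j in [set: 'I_N]) [set w | `|t j w - ratr (p.1 0 j)| <= p.2.+1%:R^-1]).
  rewrite bigcup_mkcond; apply: countable_bigcupT_measurable => [|p].
    exact: countableP.
  case: ifP => _ //; apply: fin_bigcap_measurable => // j _.
  by apply: measurable_norm_le; apply: measurable_funB.
apply/seteqP; split=> [w /= Ow|w [p Qp /= wp]]; last first.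
  by apply: Qp => j; rewrite mxE; exact: (wp j I).
have [e /= e0 eO] := (nbhs_ballP _ _).1 (open_nbhs_nbhs (conj oO Ow)).
pose k := Num.trunc (2 / e).
have k0 : 0 < k.+1%:R^-1 :> R by rewrite invr_gt0.
have ke : k.+1%:R^-1 * 2 < e.
  have /andP[_] := truncn_itv (ltW (divr_gt0 (ltr0n R 2) e0)).
  by rewrite -/k ltr_pdivrMr// => h; rewrite mulrC ltr_pdivrMr// mulrC.
have /choice[q qP] j : exists q : rat, `|t j w - ratr q| <= k.+1%:R^-1.
  move: k0; set a := k.+1%:R^-1 => a0.
  have /rat_in_itvoo[q] : t j w - a < t j w + a by lra.
  rewrite in_itv /= => /andP[? ?]; exists q.
  by rewrite ler_norml; apply/andP; split; lra.
exists (\row_j q j, k) => /=; last by move=> j _ /=; rewrite mxE.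
move=> v vq; apply: eO; split=> // i j; rewrite (ord1 i) mxE /ball /=.
have := vq j; rewrite /= mxE distrC => h.
rewrite -(subrKA (ratr (q j))) (le_lt_trans (ler_normD _ _))//.
by have := qP j; move: h ke; set a := k.+1%:R^-1; lra.
Qed.

Lemma measurable_continuous_comp d (T : measurableType d) (N : nat)
    (E : ptopologicalType) (t : 'I_N -> T -> R) (g : 'rV[R]_N -> E) :
  (forall j, measurable_fun [set: T] (t j)) -> continuous g ->
  measurable_fun [set: T]
    (fun w => g (\row_j t j w) : g_sigma_algebraType (@open E)).
Proof.
move=> mt cg; apply: measurability; first reflexivity.
move=> _ [V oV <-]; rewrite setTI.
apply: (@measurable_open_preimage _ _ _ t (g @^-1` V)) => //.
by have /continuousP h := cg; exact: h.
Qed.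

End measure_lemmas.

(** The Cantor digit number [pickle (k, i, b)] holds bit [b] of the [k]-th letter of the [i]-th
    word, so one branch encodes [n] words over four letters. Two different letters differ in some
    bit [b], and [phi i b] separates the points accordingly. *)
Lemma probe_functions (R : realType) (X : metricType R) (n : nat) :
  compact [set: X] -> ~ countable [set: X] ->
  exists phi : 'I_n -> bool -> X -> R, (forall i b, continuous (phi i b)) /\
  forall m, exists x : {ffun 'I_n -> m.-tuple (bool * bool)} -> X,
    forall (w w' : {ffun 'I_n -> m.-tuple (bool * bool)}) i l, (l < m)%N ->
      (forall k, (k < l)%N ->
        nth (false, false) (w i) k = nth (false, false) (w' i) k) ->
      nth (false, false) (w i) l <> nth (false, false) (w' i) l ->
      exists b, 3 ^- l.+1 / 2 <= `|phi i b (x w) - phi i b (x w')|.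
Proof.
move=> cX uX; have [U [y [cU U01 Uy]]] := cantor_scheme cX uX.
pose u (i : 'I_n) (b : bool) (k : nat) := U (pickle (k, i, b)).
have /choice[phi phiP] (p : 'I_n * bool) : exists phi : X -> R,
    continuous phi /\ forall x x' l,
      (forall k, (k < l)%N -> u p.1 p.2 k x = u p.1 p.2 k x') ->
      `|u p.1 p.2 l x - u p.1 p.2 l x'| = 1 ->
      3 ^- l.+1 / 2 <= `|phi x - phi x'|.
  have [phi ? ?] := @digit_series R X (u p.1 p.2) (fun k => cU _) (fun k => U01 _).
  by exists phi.
exists (fun i b => phi (i, b)); split=> [i b|m]; first by have [] := phiP (i, b).
pose bit (b : bool) (a : bool * bool) := if b then a.2 else a.1.
pose digit (w : {ffun 'I_n -> m.-tuple (bool * bool)}) (N : nat) : bool :=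
  if unpickle N is Some (k, i, b) then bit b (nth (false, false) (w i) k)
  else false.
have uE w i b k : u i b k (y (digit w)) = (bit b (nth (false, false) (w i) k))%:R.
  by rewrite /u Uy /digit pickleK.
exists (fun w => y (digit w)) => w w' i l lm kl nl.
have [b bl] : exists b, bit b (nth (false, false) (w i) l)
    != bit b (nth (false, false) (w' i) l).
  move: nl; case: (nth _ (w i) l) => a1 a2; case: (nth _ (w' i) l) => b1 b2 nl.
  have [e1|?] := eqVneq a1 b1; last by exists false.
  by exists true; apply/eqP => /= e2; apply: nl; rewrite e1 e2.
exists b; have [_ h] := phiP (i, b); apply: h => [k kl'|] /=.
  by rewrite !uE kl.
rewrite !uE; move: bl; case: (bit _ _); case: (bit _ _) => //= _.
  by rewrite subr0 normr1.
by rewrite sub0r normrN normr1.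
Qed.

(** * The finite-dimensional probe in the space of continuous functions *)

Section probe.
Variables (R : realType) (X : metricType R) (cX : compact [set: X]) (n : nat).
Local Notation E := (contfun cX (eucl R n)).

Lemma coord_dist_le (f g : E) x i :
  `|(f x : 'rV[R]_n) 0 i - (g x : 'rV[R]_n) 0 i| <= `|f - g|.
Proof.
have := coord_le_enorm ((f x : 'rV[R]_n) - (g x : 'rV[R]_n)) i.
by rewrite !mxE => /le_trans; apply; exact: (le_supnorm (f - g) x).
Qed.

(** A pair with a coordinate gap a > r stays apart under perturbations of norm below (a - r) / 2,
    and there are finitely many pairs. *)
Lemma open_close_pairs (W : finType) (x : W -> X) (r : R) (K : nat) :
  open [set f : E | (#|close_pairs f x r| < K)%N].
Proof.
rewrite openE => f /= fK.
have h (p : W * W) : nbhs f [set g : E | p \in close_pairs g x r ->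
      p \in close_pairs f x r].
  have [pf|] := boolP (p \in close_pairs f x r); first
    by apply: filterS (@filterT _ (nbhs f) _) => g _.
  rewrite inE negb_forall => /existsP[i]; rewrite -ltNge => rp.
  set a := `|_| in rp; have ar : 0 < (a - r) / 2 by rewrite divr_gt0// subr_gt0.
  have : nbhs f (ball f ((a - r) / 2)) by exact: nbhsx_ballx.
  apply: filterS => g; rewrite -ball_normE /= => fg.
  rewrite inE => /forallP/(_ i) /= gp; exfalso; move: fg.
  have := coord_dist_le f g (x p.1) i; have := coord_dist_le f g (x p.2) i.
  move: gp rp; rewrite {ar}/a.
  move: ((f (x p.1) : 'rV[R]_n) 0 i) ((f (x p.2) : 'rV[R]_n) 0 i)
        ((g (x p.1) : 'rV[R]_n) 0 i) ((g (x p.2) : 'rV[R]_n) 0 i) => a1 a2 b1 b2.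
  rewrite !ler_norml => /andP[? ?] + /andP[? ?] /andP[? ?].
  have [?|?] := lerP 0 (a1 - a2); [rewrite ger0_norm//|rewrite ltr0_norm//]; lra.
have hh : nbhs f [set g : E | forall p, p \in close_pairs g x r ->
      p \in close_pairs f x r].
  exact: (@filter_forall _ _ (fun p (g : E) => p \in close_pairs g x r ->
    p \in close_pairs f x r) (nbhs f) _ h).
apply: filterS hh => g gh /=.
apply: leq_ltn_trans fK; apply: subset_leq_card.
by apply/fintype.subsetP => p; exact: gh.
Qed.

Let fun_axis (phi : X -> R) (i : 'I_n) (x : X) : eucl R n :=
  phi x *: (delta_mx 0 i : 'rV[R]_n).

Let fun_axis_continuous phi i : continuous phi ->
  fun_axis phi i \in @continuous_pred X (eucl R n).
Proof.
by move=> cphi; rewrite inE => x; apply: cvgZr_tmp; exact: cphi.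
Qed.

Definition axis_fun phi i (cphi : continuous phi) : E :=
  ContFun cX (fun_axis_continuous i cphi).

Lemma contfun_sum_coord (I : finType) (a : I -> R) (e : I -> E) x i :
  ((\sum_j a j *: e j) x : 'rV[R]_n) 0 i = \sum_j a j * (e j x : 'rV[R]_n) 0 i.
Proof.
apply: (big_ind2 (fun (g : E) (z : R) => (g x : 'rV[R]_n) 0 i = z)).
- by rewrite [LHS]mxE.
- by move=> g1 z1 g2 z2 <- <-; rewrite [LHS]mxE.
- by move=> j _; rewrite [LHS]mxE.
Qed.

Lemma combination_continuous (N : nat) (e : 'I_N -> E) :
  continuous (fun v : 'rV[R]_N => \sum_j v 0 j *: e j).
Proof.
elim: (index_enum _) => [|j s IH] v.
  by under eq_fun do rewrite big_nil; exact: cst_continuous.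
under eq_fun do rewrite big_cons.
have cj : (fun u : 'rV[R]_N => u 0 j) @ nbhs v --> v 0 j.
  exact: coord_continuous.
by apply: (cvgD (F := nbhs v)); [exact: cvgZr_tmp cj|exact: IH].
Qed.

End probe.

(** * Shyness of the exceptional set *)

Section shy_crowded.
Variables (R : realType) (X : metricType R) (cX : compact [set: X]) (n : nat).
Local Notation E := (contfun cX (eucl R n)).
Local Notation word m := {ffun 'I_n -> m.-tuple (bool * bool)}.

(** The functions for which the number of close pairs per word tends to infinity with [m]. Outside
    this set some constant works for infinitely many [m]. *)
Definition crowded (x : forall m, word m -> X) : set E :=
  \bigcap_k \bigcup_M \bigcap_(m in [set m | (M <= m)%N])
    [set f : E | (k.+1 * #|{: word m}| <= #|close_pairs f (x m) (4 ^- m)|)%N].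

Lemma card_word m : #|{: word m}| = ((4 ^ m) ^ n)%N.
Proof. by rewrite card_ffun card_tuple card_prod card_bool card_ord. Qed.

(** The sum over families of words factors over the coordinates, and at r = 4^-m each factor is at
    most 1 + 36. *)
Lemma sum_prod_word_weight m (w : word m) :
  \sum_(w' : word m) \prod_i word_weight (4 ^- m : R) (w i) (w' i) <= 37 ^+ n.
Proof.
rewrite -(bigA_distr_bigA (fun i (v : m.-tuple _) => word_weight (4 ^- m : R) (w i) v)).
apply: (@le_trans _ _ (\prod_(i < n) 37)); last by rewrite prodr_const card_ord.
have p4 : 0 < 4 ^- m :> R by rewrite invr_gt0 exprn_gt0.
apply: ler_prod => i _; apply/andP; split.
  by apply: sumr_ge0 => v _; exact/word_weight_ge0/ltW.
apply: le_trans (sum_word_weight _ (ltW p4) _) _.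
  by rewrite card_prod card_bool.
by rewrite -mulrA mulVf ?expf_neq0// mulr1; lra.
Qed.

Lemma measurable_close_pairs (W : finType) (x : W -> X) (r : R) (K : nat) :
  borel_set [set f : E | (K <= #|close_pairs f x r|)%N].
Proof.
have : @measurable _ (g_sigma_algebraType (@open E))
    [set f : E | (#|close_pairs f x r| < K)%N].
  by apply: sub_sigma_algebra; exact: open_close_pairs.
move=> /measurableC; rewrite (_ : ~` _ = [set f : E | (K <= #|close_pairs f x r|)%N]) //.
apply/seteqP; split=> f /= h; first by rewrite leqNgt; exact/negP.
by apply/negP; rewrite -leqNgt.
Qed.

Lemma borel_crowded x : borel_set (crowded x).
Proof.
have : @measurable _ (g_sigma_algebraType (@open E)) (crowded x); last by [].
apply: bigcapT_measurable => k; apply: bigcupT_measurable => M.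
apply: bigcap_measurable => [|m _]; first by exists M => /=.
exact: measurable_close_pairs.
Qed.

Lemma shy_crowded : ~ countable [set: X] ->
  exists x : forall m, word m -> X, shy_borel (crowded x).
Proof.
move=> uX; have [phi [cphi xP]] := probe_functions n cX uX.
pose x m := projT1 (cid (xP m)); have xD m := projT2 (cid (xP m)).
exists x; split; first exact: borel_crowded.
have [d [T [P [t [mt t01 tP]]]]] := random_coefficients R n.
pose N := #|{: 'I_n * bool}|; pose ev (j : 'I_N) : 'I_n * bool := enum_val j.
pose e (j : 'I_N) : E := axis_fun cX (ev j).1 (cphi (ev j).1 (ev j).2).
pose L (v : 'rV[R]_N) : E := \sum_j v 0 j *: e j.
pose s (j : 'I_N) := t (ev j).1 (ev j).2.
pose F (w : T) : E := L (\row_j s j w).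
have mF : measurable_fun [set: T] (F : T -> g_sigma_algebraType (@open E)).
  apply: measurable_continuous_comp => [j|]; first exact: mt.
  exact: combination_continuous.
have FE w y i : (F w y : 'rV[R]_n) 0 i
    = t i false w * phi i false y + t i true w * phi i true y.
  rewrite contfun_sum_coord.
  pose G (p : 'I_n * bool) := t p.1 p.2 w * (phi p.1 p.2 y * (i == p.1)%:R).
  transitivity (\sum_(p : 'I_n * bool) G p).
    rewrite [RHS](reindex ev) /=; last exact/onW_bij/enum_val_bij.
    apply: eq_bigr => j _.
    by rewrite mxE /G; congr (_ * _); rewrite /e /axis_fun /= !mxE eqxx.
  rewrite -(pair_bigA _ (fun i b => G (i, b))) /= (bigD1 i)//= [X in _ + X]big1 ?addr0.
    by rewrite big_bool /G /= eqxx !mulr1 addrC.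
  move=> j ji; rewrite big_bool /G /= eq_sym (negbTE ji) !mulr0 addr0.
  by [].
have [Q QE] := pushforward_probability P mF.
exists Q.
  (* The support is the continuous image of a cube; as the coefficients never leave [0, 1], the
     preimage of its complement is empty. *)
  exists (L @` [set v : 'rV[R]_N | forall j, `[0, 1]%classic (v ord0 j)]).
    apply: continuous_compact.
      by apply: continuous_subspaceT; exact: combination_continuous.
    apply: (@rV_compact R N (fun=> `[0, 1]%classic)) => j.
    exact: segment_compact.
  rewrite QE (_ : _ @^-1` _ = set0) ?measure0// -subset0 => w /=; apply.
  by exists (\row_j s j w) => // j; rewrite mxE /= in_itv /=; exact: t01.
move=> y; rewrite QE.
pose B k m := [set w : T | (k.+1 * #|{: word m}|
  <= #|close_pairs (F w - y : E)%R (x m) (4 ^- m)|)%N].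
rewrite (_ : _ @^-1` _ =
  \bigcap_k \bigcup_M \bigcap_(m in [set m | (M <= m)%N]) B k m); last first.
  apply/seteqP; split=> w.
    move=> [f fB /= fy] k kT; have [M MT h] := fB k kT.
    have fE : F w - y = f by rewrite -fy addrK.
    exists M => // m mM; exact: (eq_ind_r (fun g : E =>
      (k.+1 * #|{: word m}| <= #|close_pairs g (x m) (4 ^- m)|)%N) (h m mM) fE).
  by move=> wB; exists (F w - y); [exact: wB|rewrite subrK].
have mB k m : measurable (B k m).
  have /continuousP cy : continuous (fun f : E => f - y).
    move=> f; apply: (cvgB (F := nbhs f)); [exact: cvg_id|exact: cvg_cst].
  have oS := cy _ (@open_close_pairs R X cX n _ (x m) (4 ^- m)
    (k.+1 * #|{: word m}|)%N).
  have := mF measurableT _ (@sub_sigma_algebra _ setT (@open E) _ oS).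
  rewrite setTI => /measurableC; rewrite (_ : ~` _ = B k m) //.
  apply/seteqP; split=> w /= h; first by rewrite /B /= leqNgt; exact/negP.
  by apply/negP; rewrite -leqNgt.
apply: (@null_bigcap_liminf _ _ _ _ _ (37 ^+ n)) => // k m.
pose A (p : word m * word m) :=
  [set w | p \in close_pairs (F w - y : E) (x m) (4 ^- m)].
(* The translate [y] enters only through these constants, on which the probability bound does not
   depend. *)
pose c (p : word m * word m) i :=
  (y (x m p.2) : 'rV[R]_n) 0 i - (y (x m p.1) : 'rV[R]_n) 0 i.
pose v (p : word m * word m) i b := phi i b (x m p.1) - phi i b (x m p.2).
have AE p : A p = [set w | forall i, `|c p i + t i false w * v p i false
    + t i true w * v p i true| <= 4 ^- m].
  have aux w i : ((F w - y : E) (x m p.1) : 'rV[R]_n) 0 i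
      - ((F w - y : E) (x m p.2) : 'rV[R]_n) 0 i =
      c p i + t i false w * v p i false + t i true w * v p i true.
    have yE z : ((F w - y : E) z : 'rV[R]_n) 0 i =
        (F w z : 'rV[R]_n) 0 i - (y z : 'rV[R]_n) 0 i by rewrite [LHS]mxE [X in _ + X]mxE.
    rewrite !yE !FE /c /v; ring.
  apply/seteqP; split=> w /=; rewrite /A /= inE.
    by move=> /forallP h i; rewrite -aux; exact: h.
  by move=> h; apply/forallP => i; rewrite aux; exact: h.
have mA p : measurable (A p).
  rewrite AE (_ : [set w | _] = \bigcap_(i in [set: 'I_n]) [set w |
    `|c p i + t i false w * v p i false + t i true w * v p i true| <= 4 ^- m]).
    apply: fin_bigcap_measurable => // i _; apply: measurable_norm_le.
    by apply: measurable_funD; [apply: measurable_funD|] => //; apply: measurable_funM.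
  by apply/seteqP; split=> w /= h => [i _|i]; [exact: h|exact: (h i I)].
have p4 : 0 < 4 ^- m :> R by rewrite invr_gt0 exprn_gt0.
have PA p : (P (A p) <= (\prod_i word_weight (4 ^- m) (p.1 i) (p.2 i))%:E)%E.
  rewrite AE; apply: (tP (c p) (v p)) => [|i|i]; first exact: ltW.
    exact/word_weight_ge0/ltW.
  have [|->|[l [lm kl nl ->]]] := @word_weightP R _ (false, false) (4 ^- m) (p.1 i) (p.2 i).
  - by rewrite !size_tuple.
  - by left.
  right; rewrite size_tuple in lm; have [b vb] := xD m p.1 p.2 i l lm kl nl.
  have l3 : 0 < 3 ^- l.+1 :> R by rewrite invr_gt0 exprn_gt0.
  have v0 : 0 < `|v p i b| by apply: lt_le_trans vb; rewrite divr_gt0.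
  exists b; first by rewrite -normr_gt0.
  rewrite ler_pdivrMr//.
  (* This is where the weight 12 r 3^l comes from: it equals 2r divided by the separation 3^-(l+1) /
     2. *)
  have h : 12 * 4 ^- m * 3 ^+ l * (3 ^- l.+1 / 2) <= 12 * 4 ^- m * 3 ^+ l * `|v p i b|.
    by rewrite ler_wpM2l// !mulr_ge0 ?(ltW p4) ?exprn_ge0.
  apply: le_trans h; rewrite exprS le_eqVlt; apply/orP; left; apply/eqP.
  field; rewrite !expf_neq0//.
have := @finite_markov _ _ _ P _ A (k.+1 * #|{: word m}|) (B k m) mA (mB k m).
move=> /(_ _)/le_trans h.
have W0 : 0 < #|{: word m}|%:R :> R by rewrite ltr0n card_word !expn_gt0.
rewrite -(@lee_pmul2l _ (#|{: word m}|%:R%:E))// ?lte_fin//.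
rewrite muleA -EFinM -natrM mulnC. apply: h.
  move=> w wB; apply: leq_trans wB _; apply: subset_leq_card.
  by apply/fintype.subsetP => p pA; rewrite inE; exact: pA.
apply: (@le_trans _ _ (\sum_(p : word m * word m)
    (\prod_i word_weight (4 ^- m) (p.1 i) (p.2 i))%:E)%E).
  by apply: lee_sum => p _; exact: PA.
rewrite sumEFin -EFinM lee_fin.
rewrite -(pair_bigA _ (fun w w' : word m => \prod_i word_weight (4 ^- m) (w i) (w' i))) /=.
apply: (@le_trans _ _ (\sum_(w : word m) 37 ^+ n)).
  by apply: ler_sum => w _; exact: sum_prod_word_weight.
by rewrite sumr_const mulr_natl.
Qed.

End shy_crowded.

Lemma hausdorff_dim_graph_ge_not_crowded (R : realType) (X : metricType R)
    (cX : compact [set: X]) (n : nat)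
    (x : forall m, {ffun 'I_n -> m.-tuple (bool * bool)} -> X)
    (f : contfun cX (eucl R n)) : (0 < n)%N -> ~ crowded x f ->
  (n%:R%:E <= hausdorff_dim (graph f))%E.
Proof.
move=> n_gt0 /existsNP[k]; rewrite not_implyE => -[_ nk].
apply: (@hausdorff_dim_graph_ge R X cX n f n_gt0 _ k.+1%:R).
  by move=> y; exact: contfun_continuous.
(* From 4^m > m >= M it follows that 4^m > 1 / rho, so the scale 4^-m is below [rho]. *)
move=> rho rho0; pose M := Num.trunc rho^-1.
have [m [Mm mk]] : exists m, (M <= m)%N /\
    (#|close_pairs f (x m) (4 ^- m)|
      < k.+1 * #|{: {ffun 'I_n -> m.-tuple (bool * bool)}}|)%N.
  apply: contrapT => h; apply: nk; exists M => // m /= Mm.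
  by rewrite leqNgt; apply/negP => mk; apply: h; exists m.
exists _, (x m), (4 ^- m); split; last by rewrite -natrM ler_nat ltnW.
  rewrite invr_gt0 exprn_gt0//=.
  have /andP[_ M1] := truncn_itv (ltW (etrans (invr_gt0 rho) rho0)).
  rewrite invf_ple ?posrE ?exprn_gt0//; apply/ltW/(lt_le_trans M1).
  by rewrite -natrX ler_nat (leq_ltn_trans Mm)// ltn_expl.
by rewrite card_word !natrX -exprMn mulVf ?expf_neq0// expr1n.
Qed.

Lemma contfun_bounded (R : realType) (X : metricType R)
    (cX : compact [set: X]) (n : nat) (f : contfun cX (eucl R n)) x i :
  `|(f x : 'rV[R]_n) 0 i| <= supnorm f.
Proof. exact: le_trans (coord_le_enorm _ _) (le_supnorm f x). Qed.

Theorem corollary1p9 (R : realType) (X : metricType R)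
    (cX : compact [set: X]) (uX : ~ countable [set: X])
    (n : nat) (n_gt0 : (0 < n)%N) :
  (hausdorff_dim [set: X] = 0%E ->
    prevalent [set f : contfun cX (eucl R n) |
      hausdorff_dim (graph f) = n%:R%:E]) /\
  (packing_dim [set: X] = 0%E ->
    prevalent [set f : contfun cX (eucl R n) |
      hausdorff_dim (graph f) = n%:R%:E /\
      packing_dim (graph f) = n%:R%:E]).
Proof.
have [x shyx] := shy_crowded cX n uX.
have lb := @hausdorff_dim_graph_ge_not_crowded R X cX n x.
(* One exceptional set serves both claims; outside it the lower bound [fn] holds whatever the
   dimension of [X]. *)
split=> X0; exists (crowded x) => // f /=; apply: contra_notP => /(lb f n_gt0) fn.
  apply/eqP; rewrite eq_le fn andbT.
  have := hausdorff_dim_graph_le n_gt0 (supnorm_ge0 f) (contfun_bounded f).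
  by rewrite X0 add0e.
have pf : (packing_dim (graph f) <= n%:R%:E)%E.
  apply/lee_addgt0Pr => e e0; rewrite addeC -EFinD.
  apply: (packing_dim_graph_le n_gt0 (supnorm_ge0 f) (contfun_bounded f)).
  by rewrite X0 lte_fin.
have hp (t : R) : 0 < t -> (packing_dim (graph f) < t%:E)%E -> n%:R <= t.
  move=> t0 /(hausdorff_dim_le_packing t0) h.
  by rewrite -lee_fin (le_trans fn).
have n0 : 0 < n%:R :> R by rewrite ltr0n.
split; apply/eqP; rewrite eq_le ?fn ?pf ?andbT /=.
  apply/lee_addgt0Pr => e e0; rewrite -EFinD.
  apply: hausdorff_dim_le_packing; first by rewrite addr_gt0.
  by apply: le_lt_trans pf _; rewrite lte_fin ltrDl.
rewrite leNgt; apply/negP => pn.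
(* The comparison of the two dimensions needs a positive exponent, while the packing dimension could
   a priori be negative; the maximum with n / 2 keeps [t] positive and below [n]. *)
have [t [t0 pt tn]] : exists t : R, [/\ 0 < t, (packing_dim (graph f) < t%:E)%E
    & t < n%:R].
  move: pn; case: packing_dim => [p| |]//.
    rewrite lte_fin => pn; exists (Num.max (n%:R / 2) ((p + n%:R) / 2)).
    rewrite lt_max divr_gt0//= lte_fin lt_max gt_max.
    split=> //; [apply/orP; right; lra|apply/andP; split; lra].
  by move=> _; exists (n%:R / 2); rewrite ltNyr; split=> //; [rewrite divr_gt0|lra].
by have := hp t t0 pt; rewrite leNgt tn.
Qed.
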